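(* Let $\mathcal{R}$ be an ergodic hyperfinite equivalence relation of type III$_0$ on a standard $\sigma$-finite measure space $(X,\mathfrak{B},\mu)$. If the associated flow $\{F_t\}_{t\in\mathbb{R}}$ of $\mathcal{R}$ has Property B, then $\mathcal{R}$ does not have Property A.
   Context: **Flows and Property B.** A measurable flow on a standard $\sigma$-finite measure space $(Y,\mathfrak{C},\nu)$ is a one-parameter group $\{F_t\}_{t\in\mathbb{R}}$ of nonsingular automorphisms such that $(y,t)\mapsto F_t(y)$ is measurable. For $A\in\mathfrak{C}$ of positive measure and $s,\delta>0$ put $\Lambda_{F,\delta,s}(A)=\{y\in A:\ \exists t\in(e^{s-\delta},e^{s+\delta})\cup(-e^{s+\delta},-e^{s-\delta}),\ F_t(y)\in A\}$. The flow has Property B if there is a measurable set $A\subseteq Y$ of positive measure such that for all $\delta>0$, $\limsup_{s\to\infty}\nu(\Lambda_{F,\delta,s}(A))=0$. Property B is invariant under conjugacy of flows. **Equivalence relations.** A countable measured equivalence relation $\mathcal{R}$ on $(X,\mathfrak{B},\mu)$ has countable classes, is a measurable subset of $X\times X$, and saturations of null sets are null. It is ergodic if every invariant measurable set is null or conull; finite if almost all classes are finite; hyperfinite if, up to a null set, it is an increasing union of finite relations. The full group $[\mathcal{R}]$ is the group of nonsingular automorphisms $\phi$ with $(x,\phi(x))\in\mathcal{R}$ for a.e. $x$. For a $\sigma$-finite measure $\nu\sim\mu$, $\delta_\nu$ is the Radon-Nikodym cocycle of $\nu$ with respect to $\mathcal{R}$, with the convention $\delta_\nu(\phi(x),x)=\frac{d\nu\circ\phi}{d\nu}(x)$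 for $\phi\in[\mathcal{R}]$; write $\delta=\delta_\mu$. $\mathcal{R}$ is of type III if there is no $\sigma$-finite $\mathcal{R}$-invariant measure equivalent to $\mu$, and of type III$_0$ if it is of type III and its asymptotic ratio set is $\{0,1\}$. **Associated flow.** Replacing $\mu$ by an equivalent measure, one may take $\mu$ to be lacunary: there is $\varepsilon>0$ such that for $(x,y)\in\mathcal{R}$ either $\log\delta(x,y)=0$ or $|\log\delta(x,y)|>\varepsilon$. Put $\xi(x)=\min\{\log\delta(x',x): (x',x)\in\mathcal{R},\ \log\delta(x',x)>0\}$, and let $\mathcal{S}$ be the relation $(x,y)\in\mathcal{S}$ iff $(x,y)\in\mathcal{R}$ and $\delta(x,y)=1$. Let $X_0$ be the quotient of $X$ by the $\sigma$-algebra $\mathfrak{B}(\mathcal{S})$ of $\mathcal{S}$-invariant sets (the space of ergodic components of $\mathcal{S}$), $\pi:X\to X_0$ the quotient map, $\mu_0=\mu\circ\pi^{-1}$. The function $\xi$ is $\mathfrak{B}(\mathcal{S})$-measurable and so is regarded as a function on $X_0$. An ergodic automorphism $T$ of $X_0$ is defined by $T(\pi(x))=\pi(x')$, where $(x,x')\in\mathcal{R}$ and $\log\delta(x',x)=\xi(\pi(x))$. The associated flow of $\mathcal{R}$ is (up to conjugacy) the flow built under the function $\xi$ with base automorphism $T$: on $\{(z,u)\in X_0\times\mathbb{R}: 0\le u<\xi(z)\}$ with the restriction of $\mu_0\times$Lebesgue, a point moves upward at unit speed and $(z,\xi(z))$ is identified with $(T(z),0)$. **Property A.** For $A\in\mathfrak{B}$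 of positive measure, $x\in A$, and $\nu\sim\mu$ $\sigma$-finite, let $\Lambda_{\nu,A,\mathcal{R}}(x)=\{\log\delta_\nu(y,x): (x,y)\in\mathcal{R},\ y\in A\}$, and for $s,\zeta>0$ let $K_{\nu,\mathcal{R}}(A,s,\zeta)$ be the set of $x\in A$ such that $\Lambda_{\nu,A,\mathcal{R}}(x)$ meets $(e^{s-\zeta},e^{s+\zeta})\cup(-e^{s+\zeta},-e^{s-\zeta})$. $\mathcal{R}$ has Property A if there exist a $\sigma$-finite measure $\nu\sim\mu$ and $\eta,\zeta>0$ such that every $A\in\mathfrak{B}$ of positive measure contains a set $B\in\mathfrak{B}$ of positive measure with $\limsup_{s\to\infty}\nu(K_{\nu,\mathcal{R}}(B,s,\zeta))>\eta\cdot\nu(B)$. *)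

(* Defs.v *)
From HB Require Import structures.
From mathcomp Require Import all_boot all_order all_algebra.
From mathcomp Require Import all_classical all_reals all_analysis.

Set Implicit Arguments.
Unset Strict Implicit.
Unset Printing Implicit Defensive.

Import Order.TTheory GRing.Theory Num.Theory.
Import numFieldNormedType.Exports.

Local Open Scope classical_set_scope.
Local Open Scope ring_scope.

(* Sets arising by projection (such as [returns] below) are in general only
   analytic, hence universally measurable but not Borel.  Their measure, which
   is that of the completion, is taken through the outer measure [mu_ext]. *)

Section MeasureSpaces.
Context {R : realType}.

(* Borel isomorphic to a Polish space *)
Definition standard_borel d (X : measurableType d) : Prop :=
  exists (P : completePseudoMetricType R) (f : X -> P),
    [/\ hausdorff_space P, @second_countable P, bijective f &
        @measurable d X = [set f @^-1` B | B in <<s (@open P) >>]].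

Definition equiv_measure d (X : measurableType d) (mu nu : set X -> \bar R) :=
  mu `<< nu /\ nu `<< mu.

Definition nonsingular_automorphism d (X : measurableType d)
    (mu : set X -> \bar R) (phi : X -> X) : Prop :=
  (exists psi : X -> X, [/\ cancel phi psi, cancel psi phi,
     measurable_fun [set: X] phi & measurable_fun [set: X] psi]) /\
  (forall A, measurable A -> (mu (phi @^-1` A) = 0%E <-> mu A = 0%E)).

End MeasureSpaces.

Section Flows.
Context {R : realType}.

Definition measurable_flow d (Y : measurableType d) (nu : set Y -> \bar R)
    (F : R -> Y -> Y) : Prop :=
  [/\ forall y, F 0 y = y,
      forall s t y, F (s + t) y = F s (F t y),
      forall t, nonsingular_automorphism nu (F t) &
      measurable_fun [set: Y * R] (fun p : Y * R => F p.2 p.1)].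

Definition window (s delta : R) : set R :=
  [set t | expR (s - delta) < t < expR (s + delta)] `|`
  [set t | - expR (s + delta) < t < - expR (s - delta)].

Definition returns (Y : Type) (F : R -> Y -> Y) (delta s : R) (A : set Y) :
    set Y :=
  [set y | A y /\ exists2 t, window s delta t & A (F t y)].

Definition propertyB d (Y : measurableType d) (nu : set Y -> \bar R)
    (F : R -> Y -> Y) : Prop :=
  exists A : set Y, [/\ measurable A, (0 < nu A)%E &
    forall delta : R, 0 < delta ->
      limf_esup (fun s : R => mu_ext nu (returns F delta s A)) (pinfty_nbhs R) = 0%E].

Definition conjugate_flows d (Y : measurableType d) (nu : set Y -> \bar R)
    (F : R -> Y -> Y) d' (Z : measurableType d') (la : set Z -> \bar R)
    (G : R -> Z -> Z) : Prop :=
  exists (Phi : Y -> Z) (Psi : Z -> Y),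
    [/\ measurable_fun [set: Y] Phi /\ measurable_fun [set: Z] Psi,
        {ae nu, forall y, Psi (Phi y) = y},
        {ae la, forall z, Phi (Psi z) = z},
        forall C, measurable C -> (nu (Phi @^-1` C) = 0%E <-> la C = 0%E) &
        {ae nu, forall y, forall t, Phi (F t y) = G t (Phi y)}].

Definition under_graph (Z : Type) (xi : Z -> R) : set (Z * R) :=
  [set p | 0 <= p.2 < xi p.1].

(* The values of [G] outside [under_graph xi] are irrelevant. *)
Definition flow_under (Z : Type) (T : Z -> Z) (xi : Z -> R)
    (G : R -> Z * R -> Z * R) : Prop :=
  [/\ forall p t, under_graph xi p -> under_graph xi (G t p),
      forall p, under_graph xi p -> G 0 p = p,
      forall p s t, under_graph xi p -> G (s + t) p = G s (G t p),
      forall z u t, 0 <= u -> 0 <= t -> u + t < xi z ->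
        G t (z, u) = (z, u + t) &
      forall z u, 0 <= u < xi z -> G (xi z - u) (z, u) = (T z, 0)].

End Flows.

Section Relations.
Context {R : realType} d (X : measurableType d).
Implicit Types (mu nu : set X -> \bar R) (E S : set (X * X)).

Definition equivalence_rel E : Prop :=
  [/\ forall x, E (x, x),
      forall x y, E (x, y) -> E (y, x) &
      forall x y z, E (x, y) -> E (y, z) -> E (x, z)].

Definition saturation E (A : set X) : set X :=
  [set y | exists2 x, A x & E (x, y)].

Definition countable_measured_rel mu E : Prop :=
  [/\ equivalence_rel E,
      forall x, countable [set y | E (x, y)],
      measurable E &
      forall A, mu.-negligible A -> mu.-negligible (saturation E A)].

Definition invariant_set E (A : set X) : Prop :=
  forall x y, E (x, y) -> A x -> A y.

Definition ergodic_rel mu E : Prop :=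
  forall A, measurable A -> invariant_set E A ->
    mu A = 0%E \/ mu (~` A) = 0%E.

Definition finite_rel mu E : Prop :=
  {ae mu, forall x, finite_set [set y | E (x, y)]}.

Definition hyperfinite_rel mu E : Prop :=
  exists S : nat -> set (X * X),
    [/\ forall n, countable_measured_rel mu (S n) /\ finite_rel mu (S n),
        forall n, S n `<=` S n.+1 &
        exists2 N : set X, mu.-negligible N &
          forall x y, ~ N x -> ~ N y ->
            (E (x, y) <-> exists n, S n (x, y))].

Definition full_group mu E : set (X -> X) :=
  [set phi | nonsingular_automorphism mu phi /\
             {ae mu, forall x, E (x, phi x)}].

(* [delta y x] is d(nu o phi)/d nu at [x] whenever [y = phi x]; the values of
   [delta] outside [E] are irrelevant.  Two such [delta] agree on [E] off an
   [E]-invariant null set. *)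
Definition RN_cocycle nu E (delta : X -> X -> R) : Prop :=
  [/\ measurable_fun E (fun p : X * X => delta p.1 p.2),
      forall x y, E (x, y) -> 0 < delta x y,
      forall x y z, E (x, y) -> E (y, z) ->
        delta x z = delta x y * delta y z &
      forall phi, full_group nu E phi -> forall A, measurable A ->
        nu (phi @` A) = (\int[nu]_(x in A) (delta (phi x) x)%:E)%E].

Definition invariant_measure nu E : Prop :=
  forall phi, full_group nu E phi ->
    forall A, measurable A -> nu (phi @` A) = nu A.

Definition type_III mu E : Prop :=
  ~ exists nu : {sigma_finite_measure set X -> \bar R},
      equiv_measure mu nu /\ invariant_measure nu E.

(* Krieger's asymptotic ratio set, as a subset of [0, +oo[ *)
Definition asymptotic_ratio_set mu E (delta : X -> X -> R) : set R :=
  [set r | 0 <= r /\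
    forall (e : R) (A : set X), 0 < e -> measurable A -> (0 < mu A)%E ->
      exists B, [/\ measurable B, B `<=` A, (0 < mu B)%E &
        exists2 phi, full_group mu E phi &
          phi @` B `<=` A /\
          forall x, B x -> `|delta (phi x) x - r| < e]].

Definition type_III0 mu E : Prop :=
  type_III mu E /\
  exists2 delta, RN_cocycle mu E delta &
    asymptotic_ratio_set mu E delta = [set 0; 1].

Definition lacunary E (delta : X -> X -> R) : Prop :=
  exists2 e : R, 0 < e &
    forall x y, E (x, y) -> ln (delta x y) = 0 \/ e < `|ln (delta x y)|.

Definition unimodular_part E (delta : X -> X -> R) : set (X * X) :=
  [set p | E p /\ delta p.1 p.2 = 1].

(* [pi] is the quotient of (X, mu) by the sigma-algebra of [S]-invariant sets:
   modulo null sets, the latter is the inverse image under [pi] of the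
   sigma-algebra of the standard Borel space [X0]. *)
Definition ergodic_decomposition mu S d0 (X0 : measurableType d0)
    (pi : X -> X0) : Prop :=
  [/\ standard_borel (R := R) X0,
      measurable_fun [set: X] pi,
      forall C, measurable C -> exists A, [/\ measurable A,
        invariant_set S A & {ae mu, forall x, C (pi x) <-> A x}] &
      forall A, measurable A -> invariant_set S A ->
        exists2 C, measurable C & {ae mu, forall x, C (pi x) <-> A x}].

Definition log_jumps E (delta : X -> X -> R) (x : X) : set R :=
  [set ln (delta x' x) | x' in
    [set x' | E (x', x) /\ 0 < ln (delta x' x)]].

(* [xi] and [T] are determined almost everywhere only.  The product measure
   makes sense, and has the right null sets, even if the image measure of [m]
   on [X0] fails to be sigma-finite. *)
Definition associated_flow mu E d' (Y : measurableType d')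
    (nu : set Y -> \bar R) (F : R -> Y -> Y) : Prop :=
  exists (m : {sigma_finite_measure set X -> \bar R}) (delta : X -> X -> R)
         (d0 : measure_display) (X0 : measurableType d0) (pi : X -> X0)
         (xi : X0 -> R) (T : X0 -> X0) (G : R -> X0 * R -> X0 * R),
    let mu0 := pushforward m pi in
    let la := fun C : set (X0 * R) =>
      (mu0 \x lebesgue_measure)%E (C `&` under_graph xi) in
    [/\ equiv_measure mu m /\ (RN_cocycle m E delta /\ lacunary E delta),
        ergodic_decomposition m (unimodular_part E delta) pi,
        [/\ measurable_fun [set: X0] xi, forall z, 0 < xi z &
            {ae m, forall x, log_jumps E delta x (xi (pi x)) /\
                             lbound (log_jumps E delta x) (xi (pi x))}],
        nonsingular_automorphism mu0 T /\
        {ae m, forall x, forall x', E (x, x') ->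
           ln (delta x' x) = xi (pi x) -> T (pi x) = pi x'} &
        flow_under T xi G /\ conjugate_flows nu F la G].

Definition log_ratios E (delta : X -> X -> R) (A : set X) (x : X) : set R :=
  [set ln (delta y x) | y in [set y | E (x, y) /\ A y]].

Definition recurrent_part E (delta : X -> X -> R) (A : set X) (s zeta : R) :
    set X :=
  [set x | A x /\ log_ratios E delta A x `&` window s zeta !=set0].

Definition propertyA mu E : Prop :=
  exists (nu : {sigma_finite_measure set X -> \bar R}) (delta : X -> X -> R)
         (eta zeta : R),
    [/\ equiv_measure mu nu, RN_cocycle nu E delta, 0 < eta, 0 < zeta &
      forall A, measurable A -> (0 < mu A)%E ->
        exists B, [/\ measurable B, B `<=` A, (0 < mu B)%E &
          (eta%:E * nu B <
           limf_esup (fun s : R =>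
             mu_ext nu (recurrent_part E delta B s zeta)) (pinfty_nbhs R))%E]].

End Relations.

(* Main.v *)
Require Import Defs.
From mathcomp Require Import all_boot all_order all_algebra.
From mathcomp Require Import all_classical all_reals all_analysis measurable_realfun.
From mathcomp Require Import ring lra.

Set Implicit Arguments.
Unset Strict Implicit.
Unset Printing Implicit Defensive.

Import Order.TTheory GRing.Theory Num.Theory.
Import numFieldNormedType.Exports.

Local Open Scope classical_set_scope.
Local Open Scope ring_scope.

(** Why the theorem holds.  Let m be the lacunary measure and T, xi, G the data
    from which the associated flow is built, and let n be the measure given by
    Property A, with cocycles dm and dn.  A subset B of A has
    K(B, s, zeta) contained in K(A, s, zeta), so Property A fails as soon as
    one set A of positive measure has n(K(A, s, zeta)) tending to 0
    ([vanishing_recurrence]).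

    Such an A comes from a set C witnessing Property B.  Along an orbit of the
    relation the flow reads off the cocycle: if (x, y) is in E then
    G_t(pi x, 0) = (pi y, 0) for t = log dm(y, x), because log dm(y, x) is,
    up to sign, a finite sum of jumps and each jump crosses one fiber of the
    flow ([orbit_flow]).  Seen in X * R, the set C has fibers over the points of X;
    let A consist of points x whose fiber has measure at least b within
    heights 0 <= u <= L.  When x and y in A are related with
    v = log dn(y, x) in the window at scale s, choose a height u' in the fiber
    over y.  Then for almost every height u in the fiber over x, the flow at
    time t + u' - u, where t = log dm(y, x), takes the point of C at (x, u) back into C.  This time differs
    from v by a bounded amount, so it lies in the window of twice the width
    once s is large.  Hence x in K(A, s, zeta) forces a set of heights u of
    measure at least b in which the point over (x, u) returns to C.  As the
    returns have measure tending to 0 and a finite measure on A * [0, L] is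
    absolutely continuous with respect to that of the flow space, a
    Borel-Cantelli argument concludes ([slices_not_bounded_below]).

    Two points need more work.  First, log dn and log dm must differ by a
    bounded amount on all related pairs in A outside a null set, whereas the
    Radon-Nikodym property only speaks of one automorphism in the full group at
    a time.  So a measurable subset of E off the diagonal, with non-null
    projection, must contain part of the graph of an element of the full group ([full_group_meets], a
    measure-theoretic form of the Feldman-Moore theorem).  It rests on a
    measurable selection theorem for measurable subsets of X * Z with Z
    standard Borel ([measurable_selection]), in the manner of Jankov and von
    Neumann: a measurable set is the result of the Suslin operation on
    rectangles, and replacing its projections by measurable hulls costs a null
    set and yields measurable branches.  Second, conjugacies invert each other
    only almost everywhere, while the returning time is an arbitrary real
    number; comparing whole orbits instead of points repairs this
    ([flow_eq_of_conj]). *)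

(** * Null sets, integrals and outer measures *)

Section NullSets.
Context d (X : measurableType d) (R : realType).
Implicit Types mu nu : {measure set X -> \bar R}.

Lemma null_dominates_negligible mu nu (A : set X) :
  mu `<< nu -> nu.-negligible A -> mu.-negligible A.
Proof.
move=> /null_content_dominatesP H [N [mN N0 AN]].
by exists N; split => //; exact: H.
Qed.

Lemma equiv_measure_null mu nu (A : set X) :
  equiv_measure mu nu -> measurable A -> mu A = 0%E <-> nu A = 0%E.
Proof.
by move=> [/null_content_dominatesP H /null_content_dominatesP K] mA; split;
  [exact: K|exact: H].
Qed.

Lemma equiv_measure_negligible mu nu (A : set X) :
  equiv_measure mu nu -> mu.-negligible A <-> nu.-negligible A.
Proof. by move=> [H K]; split; exact: null_dominates_negligible. Qed.

Lemma countable_measured_rel_equiv mu nu E : equiv_measure mu nu ->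
  countable_measured_rel mu E -> countable_measured_rel nu E.
Proof.
move=> eqv [Eeq Ec mE Esat]; split=> // A.
by move=> /(equiv_measure_negligible A eqv)/Esat/(equiv_measure_negligible _ eqv).
Qed.

Lemma full_group_equiv mu nu E : equiv_measure mu nu ->
  full_group mu E `<=` full_group nu E.
Proof.
move=> eqv phi [[bij ns] Ephi]; split; last first.
  exact: (null_dominates_negligible eqv.2 Ephi).
split=> // A mA; have [psi [_ _ mphi _]] := bij.
have mpA : measurable (phi @^-1` A).
  by rewrite -[X in measurable X]setTI; exact: mphi.
split=> [/(equiv_measure_null eqv mpA)/(ns _ mA)/(equiv_measure_null eqv mA)//|].
by move=> /(equiv_measure_null eqv mA)/(ns _ mA)/(equiv_measure_null eqv mpA).
Qed.

End NullSets.

Lemma ge0_integral_eq0_ae (R : realType) d (X : measurableType d)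
    (mu : {measure set X -> \bar R}) (h : X -> \bar R) :
  measurable_fun setT h -> (forall x, 0 <= h x)%E ->
  (\int[mu]_x h x = 0)%E <-> {ae mu, forall x, h x = 0%E}.
Proof.
move=> mh h0; have := ae_eq_integral_abs mu measurableT mh.
under eq_integral do rewrite gee0_abs//.
move=> [int_ae ae_int]; split=> [/int_ae|ae0]; first by apply: filterS => x /(_ I).
by apply: ae_int; apply: filterS ae0 => x + _.
Qed.

Lemma borel_cantelli_half (R : realType) d (X : measurableType d)
    (mu : {measure set X -> \bar R}) (U : nat -> set X) :
  (forall k, measurable (U k)) -> (forall k, mu (U k) < (1 / 2 ^+ k.+1)%:E)%E ->
  mu (lim_sup_set U) = 0%E.
Proof.
move=> mU Ult; apply: lim_sup_set_cvg0 => //.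
have h : (\sum_(0 <= n < k) (1 / 2 ^+ n.+1)%:E)%E @[k --> \oo] --> (1%E : \bar R).
  apply/fine_cvgP; split.
    by apply: nearW => /= k; rewrite sumEFin.
  have := @cvg_geometric_series_half R 1 0; rewrite {1}/series/= expr0 divr1.
  under [in X in _ -> X]eq_fun do rewrite sumEFin.
  by under eq_fun do under eq_bigr do rewrite addn1 natrX.
apply: (@le_lt_trans _ _ (\sum_(0 <= n <oo) (1 / (2 ^+ n.+1))%:E)%E).
  apply: lee_lim.
  - exact: is_cvg_ereal_nneg_natsum_cond.
  - by apply/cvg_ex; exists 1%E.
  - by apply: nearW => /= k; apply: lee_sum => i _; exact: ltW.
by move/cvg_lim : h => ->//; rewrite ltry.
Qed.

Lemma le_measure_mod_null (R : realType) d (X : measurableType d)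
    (mu : {measure set X -> \bar R}) (A B N1 N2 : set X) :
  measurable A -> measurable B -> measurable N1 -> measurable N2 ->
  mu N1 = 0%E -> mu N2 = 0%E -> A `<=` B `|` N1 `|` N2 -> (mu A <= mu B)%E.
Proof.
move=> mA mB mN1 mN2 N10 N20 AB.
rewrite -(measureU0 mB mN1 N10) -(measureU0 (measurableU _ _ mB mN1) mN2 N20).
by apply: le_measure; rewrite ?inE//; do ?apply: measurableU.
Qed.

Section OuterMeasure.
Context {R : realType} d (X : measurableType d).
Variable n : {measure set X -> \bar R}.

Lemma mu_ext_measurable_cover (K : set X) (r : \bar R) : (mu_ext n K < r)%E ->
  exists D, [/\ measurable D, K `<=` D & (n D < r)%E].
Proof.
move=> /ereal_inf_lt[_ [A [mA KA] <-] Ar].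
exists (\bigcup_k A k); split=> //; first exact: bigcupT_measurable.
apply: le_lt_trans Ar; apply: measure_sigma_subadditive => //.
exact: bigcupT_measurable.
Qed.

Lemma mu_ext_le_measure (K H : set X) : measurable H -> K `<=` H ->
  (mu_ext n K <= n H)%E.
Proof. by move=> mH KH; rewrite -(measurable_mu_extE n mH); exact: le_mu_ext. Qed.

End OuterMeasure.

(** * Measurable selection *)

Section Hull.
Context d (X : measurableType d) (R : realType).
Variable mu : {sigma_finite_measure set X -> \bar R}.

(** Minimality is required against each measurable [M] containing [A] rather
    than through the measure of [H], so that it makes sense, and hulls exist,
    for sets of infinite measure. *)
Definition hull (A H : set X) : Prop :=
  [/\ measurable H, A `<=` H &
    forall M, measurable M -> A `<=` M -> mu (H `\` M) = 0%E].

(** The infimum of the measures of the measurable sets containing [A] is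
    attained by a countable intersection. *)
Lemma hull_finite (A F : set X) : measurable F -> (mu F < +oo)%E -> A `<=` F ->
  exists H, hull A H.
Proof.
move=> mF Foo AF.
pose S := [set mu M | M in [set M | measurable M /\ A `<=` M]].
have S0 : (0 <= ereal_inf S)%E.
  by apply: le_ereal_inf_tmp => _ [M _ <-]; exact: measure_ge0.
have SF : (ereal_inf S <= mu F)%E by apply: ereal_inf_lbound; exists F.
have Sfin : ereal_inf S \is a fin_num.
  by rewrite ge0_fin_numE//; exact: le_lt_trans Foo.
have /choice[C HC] n : exists C, [/\ measurable C, A `<=` C &
    (mu C < ereal_inf S + n.+1%:R^-1%:E)%E].
  have := @lb_ereal_inf_adherent _ S n.+1%:R^-1 _ Sfin.
  by rewrite invr_gt0 ltr0n => /(_ isT)[_ [C [mC AC] <-] lt]; exists C.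
have mC n : measurable (C n) by have [] := HC n.
have AC : A `<=` \bigcap_n C n by move=> x Ax n _; have [_ + _] := HC n; exact.
have mI : measurable (\bigcap_n C n) by exact: bigcapT_measurable.
have muI : mu (\bigcap_n C n) = ereal_inf S.
  apply/eqP; rewrite eq_le; apply/andP; split; last first.
    by apply: ereal_inf_lbound; exists (\bigcap_n C n).
  apply/lee_addgt0Pr => e e0.
  have [n ne] : exists n, n.+1%:R^-1 < e :> R.
    by have [n] := ltr_add_invr e0; rewrite add0r => ?; exists n.
  apply: (@le_trans _ _ (mu (C n))).
    by apply: le_measure; rewrite ?inE//; apply: bigcap_inf.
  have [_ _ /ltW/le_trans] := HC n; apply.
  by rewrite leeD2l// lee_fin ltW.
exists (\bigcap_n C n); split=> // M mM AM.
have IM : mu (\bigcap_n C n `&` M) = mu (\bigcap_n C n).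
  apply/eqP; rewrite eq_le; apply/andP; split.
    by apply: le_measure; rewrite ?inE//; exact: measurableI.
  rewrite muI; apply: ereal_inf_lbound; exists (\bigcap_n C n `&` M) => //.
  by split; [exact: measurableI|rewrite subsetI].
have Ioo : (mu (\bigcap_n C n) < +oo)%E by rewrite muI -ge0_fin_numE.
rewrite measureD//; transitivity (ereal_inf S - ereal_inf S)%E.
  by congr (_ - _)%E; [exact: muI|rewrite -muI; exact: IM].
by rewrite subee.
Qed.

Lemma hull_exists (A : set X) : exists H, hull A H.
Proof.
have [F FT /all_and2[mF Foo]] := sigma_finiteT mu.
have /choice[H HH] n : exists H, hull (A `&` F n) H.
  exact: (hull_finite (mF n) (Foo n)).
exists (\bigcup_n H n); split.
- by apply: bigcupT_measurable => n; have [] := HH n.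
- move=> x Ax; have [n _ Fx] : (\bigcup_n F n) x by rewrite -FT.
  by exists n => //; have [_ + _] := HH n; apply.
- move=> M mM AM; apply/negligibleP.
    by apply: measurableD => //; apply: bigcupT_measurable => n; have [] := HH n.
  rewrite setD_bigcupl; apply: negligible_bigcup => n.
  have [mH _ H0] := HH n; apply/negligibleP; first exact: measurableD.
  by apply: H0 => // x [/AM].
Qed.

End Hull.

Lemma mkseqS_cons (a : nat -> nat) k :
  mkseq a k.+1 = a 0%N :: mkseq (a \o S) k.
Proof. by rewrite /mkseq /= (iotaDl 1 0) -map_comp. Qed.

Lemma take_mkseq (a : nat -> nat) i k : (i <= k)%N ->
  take i (mkseq a k) = mkseq a i.
Proof. by move=> ik; rewrite /mkseq -map_take take_iota (minn_idPl ik). Qed.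

Section Suslin.
Context d (X : measurableType d) (R : realType) (Z : Type)
  (P : completePseudoMetricType R) (f : Z -> P).

(** The diameters tend to zero along each branch [a]. *)
Definition shrinking (V : seq nat -> set P) : Prop :=
  forall (a : nat -> nat) (e : R), 0 < e ->
    exists k, forall y z, V (mkseq a k) y -> V (mkseq a k) z -> ball y e z.

(** The Suslin operation applied to the scheme of rectangles with sides [U s]
    and the inverse image of [V s]. *)
Definition suslin_of (U : seq nat -> set X) (V : seq nat -> set P) :
    set (X * Z) :=
  [set p | exists a, forall k, U (mkseq a k) p.1 /\ V (mkseq a k) (f p.2)].

Definition suslin (Q : set (X * Z)) : Prop :=
  exists (U : seq nat -> set X) (V : seq nat -> set P),
    [/\ forall s, measurable (U s), forall s, closed (V s), shrinking V &
        Q = suslin_of U V].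

(** The first term of a branch can choose the index of the union. *)
Lemma suslin_bigcup (Q : nat -> set (X * Z)) :
  (forall n, suslin (Q n)) -> suslin (\bigcup_n Q n).
Proof.
move=> /choice[U /choice[V /all_and4[mU cV sV QE]]].
exists (fun s => if s is n :: t then U n t else setT),
       (fun s => if s is n :: t then V n t else setT); split.
- by case.
- by case=> //; exact: closedT.
- move=> a e e0; have [k Vk] := sV (a 0%N) (a \o S) e e0.
  by exists k.+1; rewrite mkseqS_cons.
- apply/seteqP; split=> [p [n _]|p [a Ha]].
    rewrite QE => -[a Ha]; exists (fun i => if i is j.+1 then a j else n).
    by case=> // k; rewrite mkseqS_cons; exact: Ha.
  exists (a 0%N) => //; rewrite QE; exists (a \o S) => k.
  by have := Ha k.+1; rewrite mkseqS_cons.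
Qed.

(* A single branch codes countably many, the [n]-th one having as [i]-th term
   the term of index [pickle (n, i)].  [covers s n k] says that [s] is long
   enough to prescribe the first [k] terms of the [n]-th one. *)
Let covers (s : seq nat) (n k : nat) : Prop :=
  forall i, (i < k)%N -> (pickle (n, i) < size s)%N.

Let component (s : seq nat) (n k : nat) : seq nat :=
  mkseq (fun i => nth 0%N s (pickle (n, i))) k.

Let component_mkseq (a : nat -> nat) m n k : covers (mkseq a m) n k ->
  component (mkseq a m) n k = mkseq (fun i => a (pickle (n, i))) k.
Proof.
move=> c; apply/eq_in_map => i; rewrite mem_iota add0n => /= ik.
by rewrite nth_mkseq//; have := c _ ik; rewrite size_mkseq.
Qed.

Let covers_ex (a : nat -> nat) n k : exists m, covers (mkseq a m) n k.
Proof.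
exists (\sum_(i < k) (pickle (n, val i)).+1)%N => i ik; rewrite size_mkseq.
by rewrite (bigD1 (Ordinal ik))//= ltn_addr.
Qed.

(** Witnesses for all the [Q n] are interleaved into one branch; a finite
    sequence then imposes the conditions on those prefixes that it covers. *)
Lemma suslin_bigcap (Q : nat -> set (X * Z)) :
  (forall n, suslin (Q n)) -> suslin (\bigcap_n Q n).
Proof.
move=> /choice[U /choice[V /all_and4[mU cV sV QE]]].
pose W T (G : nat -> seq nat -> set T) s := \bigcap_n \bigcap_k
  [set x | covers s n k -> G n (component s n k) x].
have WE T (G : nat -> seq nat -> set T) a x :
    (forall m, W T G (mkseq a m) x) <->
    (forall n k, G n (mkseq (fun i => a (pickle (n, i))) k) x).
  split=> [H n k|H m n _ k _ /component_mkseq ->//].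
  have [m c] := covers_ex a n k.
  by have := H m n I k I c; rewrite component_mkseq.
exists (W _ U), (W _ V); split.
- move=> s; apply: bigcapT_measurable => n; apply: bigcapT_measurable => k.
  case: (pselect (covers s n k)) => c.
    rewrite (_ : [set _ | _] = U n (component s n k))//.
    by apply/seteqP; split=> x //=; exact.
  rewrite (_ : [set _ | _] = setT)//.
  by apply/seteqP; split=> x //=.
- move=> s; apply: closed_bigI => n _; apply: closed_bigI => k _.
  case: (pselect (covers s n k)) => c.
    rewrite (_ : [set _ | _] = V n (component s n k))//.
    by apply/seteqP; split=> x //=; exact.
  rewrite (_ : [set _ | _] = setT); first exact: closedT.
  by apply/seteqP; split=> x //=.
- move=> a e e0.
  have [k Vk] := sV 0%N (fun i => a (pickle (0%N, i))) e e0.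
  have [m cm] := covers_ex a 0 k.
  exists m; move=> y z /(_ 0%N I k I cm) + /(_ 0%N I k I cm).
  by rewrite component_mkseq//; exact: Vk.
- apply/seteqP; split=> [p Qp|p [a Ha] n _].
    have /choice[b Hb] n : exists b, forall k,
        U n (mkseq b k) p.1 /\ V n (mkseq b k) (f p.2).
      by have := Qp n I; rewrite QE.
    pose a m := if @unpickle (nat * nat)%type m is Some ni then b ni.1 ni.2 else 0%N.
    have aE n i : a (pickle (n, i)) = b n i by rewrite /a pickleK.
    exists a => m; split; move: m.
      by apply: (iffRL (WE _ U a p.1)) => n k; under eq_mkseq do rewrite aE;
        have [] := Hb n k.
    by apply: (iffRL (WE _ V a (f p.2))) => n k; under eq_mkseq do rewrite aE;
      have [] := Hb n k.
  rewrite QE; exists (fun i => a (pickle (n, i))) => k; split.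
    by apply: (iffLR (WE _ U a p.1)) => m; have [] := Ha m.
  by apply: (iffLR (WE _ V a (f p.2))) => m; have [] := Ha m.
Qed.

End Suslin.

(** Uniform spaces are regular, so the closures of the members of a countable
    base still form a network.  Working with closed sets is what lets limits
    stay inside the sets of a scheme. *)
Lemma closed_network (P : uniformType) : @second_countable P ->
  exists W : nat -> set P, (forall j, closed (W j)) /\
    forall x A, nbhs x A -> exists j, W j x /\ W j `<=` A.
Proof.
move=> [B /countable_injP[g ginj] [Bo Bx]].
pose O j := xget set0 [set U | B U /\ g U = j].
have OE U : B U -> O (g U) = U.
  move=> BU; rewrite /O; case: xgetP => [V _ [BV gV]|/(_ U)[]]//.
  by apply: ginj; rewrite ?inE.
exists (fun j => closure (O j)); split=> [j|x A nA]; first exact: closed_closure.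
have [V nV VA] := uniform_regular nA.
have [U [BU Ux] UV] := Bx x V nV.
exists (g U); rewrite OE//; split; first exact: subset_closure.
exact: subset_trans (closure_subset UV) VA.
Qed.

Section MeasurableSuslin.
Context d (X : measurableType d) d' (Z : measurableType d') (R : realType)
  (P : completePseudoMetricType R) (f : Z -> P).
Hypothesis Pcount : @second_countable P.
Hypothesis mZ : @measurable d' Z = [set f @^-1` B | B in <<s (@open P) >>].

(** A branch lists, for each [i], a member of a closed network of diameter less
    than [1 / (i + 1)]; members that are too large are replaced by the empty
    set.  This makes the scheme shrinking without changing the rectangle. *)
Lemma suslin_closed_rect (A : set X) (B : set P) :
  measurable A -> closed B -> suslin f (A `*` f @^-1` B).
Proof.
move=> mA cB; have [W [cW nW]] := closed_network Pcount.
pose small i j := forall y z : P, W j y -> W j z -> ball y i.+1%:R^-1 z.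
pose C i j := [set y | small i j /\ W j y].
have cC i j : closed (C i j).
  case: (pselect (small i j)) => h.
    by rewrite (_ : C i j = W j)//; apply/seteqP; split=> y // [].
  by rewrite (_ : C i j = set0); [exact: closed0|apply/seteqP; split=> y // []].
exists (fun=> A), (fun s => B `&` \bigcap_i
  [set y | (i < size s)%N -> C i (nth 0%N s i) y]); split=> //.
- move=> s; apply: closedI => //; apply: closed_bigI => i _.
  case: (boolP (i < size s)%N) => h.
    rewrite (_ : [set _ | _] = C i (nth 0%N s i))//.
    by apply/seteqP; split=> x //=; exact.
  by rewrite (_ : [set _ | _] = setT); [exact: closedT|apply/seteqP; split].
- move=> a e e0; have [k ke] := ltr_add_invr e0; rewrite add0r in ke.
  exists k.+1; move=> y z [_ /(_ k I) yk] [_ /(_ k I) zk].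
  rewrite size_mkseq nth_mkseq// in yk zk.
  have [sk Wy] := yk (ltnSn k); have [_ Wz] := zk (ltnSn k).
  by apply: le_ball (sk y z Wy Wz); exact: ltW.
- apply/seteqP; split=> [[x z] [/= Ax Bz]|[x z] [a Ha]]; last first.
    by have [? []] := Ha 0%N.
  have /choice[a Ha] i : exists j, C i j (f z).
    have e0 : 0 < i.+1%:R^-1 / 2 :> R by rewrite divr_gt0// invr_gt0 ltr0n.
    have [j [Wj Wb]] := nW (f z) _ (nbhsx_ballx (f z) _ e0).
    exists j; split=> // y y' /Wb zy /Wb zy'.
    by apply: (ball_splitr (z := f z)).
  exists a => k /=; split=> //; split=> // i _ /=; rewrite size_mkseq => ik.
  by rewrite nth_mkseq.
Qed.

(** The sets that are Suslin together with their complement form a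
    sigma-algebra.  It contains the rectangles over open sets, because an open
    set is a countable union of members of a closed network. *)
Lemma suslin_measurable (Q : set (X * Z)) : measurable Q -> suslin f Q.
Proof.
have sU (A B : set (X * Z)) : suslin f A -> suslin f B -> suslin f (A `|` B).
  by move=> sA sB; rewrite -bigcup2E; apply: suslin_bigcup => -[|[|n]]//=;
    rewrite -(set0X (f @^-1` set0)); apply: suslin_closed_rect;
    [exact: measurable0|exact: closed0].
have sI (A B : set (X * Z)) : suslin f A -> suslin f B -> suslin f (A `&` B).
  by move=> sA sB; rewrite -bigcap2E; apply: suslin_bigcap => -[|[|n]]//=;
    rewrite -setXTT -(preimage_setT f); apply: suslin_closed_rect;
    [exact: measurableT|exact: closedT].
pose S := [set Q : set (X * Z) | suslin f Q /\ suslin f (~` Q)].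
have sS : sigma_algebra setT S.
  split.
  - split; first by rewrite -(set0X (f @^-1` set0)); apply: suslin_closed_rect;
      [exact: measurable0|exact: closed0].
    by rewrite setC0 -setXTT -(preimage_setT f); apply: suslin_closed_rect;
      [exact: measurableT|exact: closedT].
  - by move=> A [sA sCA]; rewrite setTD; split=> //; rewrite setCK.
  - move=> A /all_and2[sA sCA]; split; first exact: suslin_bigcup.
    by rewrite setC_bigcup; exact: suslin_bigcap.
have SX (A : set X) : measurable A -> S (A `*` setT).
  move=> mA; split.
    by rewrite -(preimage_setT f); exact: suslin_closed_rect closedT.
  rewrite (_ : ~` _ = (~` A) `*` f @^-1` setT).
    by apply: suslin_closed_rect closedT; exact: measurableC.
  by apply/seteqP; split=> [[x z] /= /not_andP[]//|[x z] [/= ? _] []].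
have SZ (B : set P) : <<s (@open P) >> B -> S (setT `*` f @^-1` B).
  have : sigma_algebra setT [set B : set P | S (setT `*` f @^-1` B)].
    have [S0 SC SU] := sS; split=> [/=|C /= SB|C SB /=].
    - by rewrite preimage_set0 setX0.
    - have := SC _ SB; congr S; apply/seteqP; split=> [[x z] [_ /= h]|[x z] [_ [_ h]]].
        by split=> //; split=> // Bz; apply: h.
      by split=> // -[_ /=].
    - have := SU _ SB; congr S; apply/seteqP; split=> [[x z] [k _ [_ h]]|[x z] [_ [k _ h]]].
        by split=> //; exists k.
      by exists k.
  move=> /smallest_sub; apply => O oO /=; split; last first.
    rewrite (_ : ~` _ = setT `*` f @^-1` (~` O)).
      by apply: suslin_closed_rect; [exact: measurableT|exact: open_closedC].
    by apply/seteqP; split=> [[x z] /= /not_andP[]//|[x z] [/= _ ?] []].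
  have [W [cW nW]] := closed_network Pcount.
  have -> : setT `*` f @^-1` O = \bigcup_j (setT `*`
      f @^-1` (if `[< W j `<=` O >] then W j else set0)) :> set (X * Z).
    apply/seteqP; split=> [[x z] [_ /= Oz]|[x z] [j _ []] /= _].
      have [j [Wj WO]] := nW (f z) O (open_nbhs_nbhs (conj oO Oz)).
      by exists j => //; split=> //=; case: asboolP.
    by case: asboolP => // WO Wz; split=> //=; exact: WO.
  apply: suslin_bigcup => j; apply: suslin_closed_rect; first exact: measurableT.
  by case: ifP => _; [exact: cW|exact: closed0].
have SI A B : S A -> S B -> S (A `&` B).
  by move=> [sA sCA] [sB sCB]; split; [exact: sI|rewrite setCI; exact: sU].
rewrite measurable_prod_measurableType.
have : <<s [set A `*` B | A in @measurable d X & B in @measurable d' Z] >> `<=` S.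
  apply: smallest_sub => // _ [A mA [B + <-]]; rewrite mZ => -[C sC <-].
  rewrite (_ : _ `*` _ = (A `*` setT) `&` (setT `*` f @^-1` C)).
    by apply: SI; [exact: SX|exact: SZ].
  by rewrite -setXI setIT setTI.
by move=> /[apply] -[].
Qed.

End MeasurableSuslin.

Section Selection.
Context d (X : measurableType d) d' (Z : measurableType d') (R : realType)
  (mu : {sigma_finite_measure set X -> \bar R}).

(** Let [A s] be the projection of the part of [Q] whose branch extends [s].  It
    is the union of the [A (rcons s j)], so outside one null set the hull [H s] of
    [A s] is covered by the hulls of the [A (rcons s j)].  Over a point [x] there,
    a branch can thus be chosen step by step with [x] in each [H s], each step
    being measurable in [x].  The sets [V s] along this branch are closed,
    shrink, and have the finite intersection property since [A s] is not
    empty; by completeness they meet in a point, which is the selected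
    value. [g0] provides values outside [D]. *)
Theorem measurable_selection (Q : set (X * Z)) (g0 : X -> Z) :
  standard_borel (R := R) Z -> measurable Q ->
  exists D phi, [/\ measurable D, measurable_fun D (phi : X -> Z),
    forall x, D x -> Q (x, phi x) &
    mu.-negligible [set x | (exists z, Q (x, z)) /\ ~ D x]].
Proof.
move=> [P [f [_ Pcount [g fK gK] mZ]]] mQ.
have [U [V [mU cV sV QE]]] := suslin_measurable Pcount mZ mQ.
pose A s := [set x | exists z a, mkseq a (size s) = s /\
  forall k, U (mkseq a k) x /\ V (mkseq a k) (f z)].
have AU s : A s `<=` U s.
  by move=> x [z [a [as_ /(_ (size s))[+ _]]]]; rewrite as_.
have AS s : A s `<=` \bigcup_j A (rcons s j).
  move=> x [z [a [as_ H]]]; exists (a (size s)) => //; exists z, a; split=> //.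
  by rewrite size_rcons mkseqS as_.
(* The hull is cut down to [U s], so that the branch lies in the scheme, and
   taken empty with [A s], so that it only has points over nonempty parts. *)
have /choice[H HH] s : exists H, [/\ measurable H, A s `<=` H, H `<=` U s,
    (forall x, H x -> A s !=set0) &
    forall M, measurable M -> A s `<=` M -> mu (H `\` M) = 0%E].
  have [/eqP A0|/set0P An0] := boolP (A s == set0).
    exists set0; split=> //; first by rewrite A0.
    by move=> M _ _; rewrite set0D measure0.
  have [H [mH AH H0]] := hull_exists mu (A s).
  exists (H `&` U s); split=> //.
  - exact: measurableI.
  - by move=> x Ax; split; [exact: AH|exact: AU].
  - move=> M mM AM; apply: subset_measure0 (H0 M mM AM) => //.
    + by apply: measurableD => //; exact: measurableI.
    + exact: measurableD.
    + by move=> x [[]].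
have mH s : measurable (H s) by have [] := HH s.
(* Making the [H (rcons s j)] disjoint determines the next term. *)
pose H' s j := seqDU (fun j => H (rcons s j)) j.
have mH' s j : measurable (H' s j) by apply: seqDU_measurable.
pose N := \bigcup_s (H s `\` \bigcup_j H (rcons s j)).
have mD s : measurable (H s `\` \bigcup_j H (rcons s j)).
  by apply: measurableD => //; exact: bigcupT_measurable.
have mN : measurable N by apply: countable_bigcupT_measurable.
have N0 : mu.-negligible N.
  have NS s : mu.-negligible (H s `\` \bigcup_j H (rcons s j)).
    apply/negligibleP => //; have [_ _ _ _] := HH s; apply.
      exact: bigcupT_measurable.
    move=> x /AS[j _ Aj]; exists j => //.
    by have [_ + _ _ _] := HH (rcons s j); exact.
  pose E (n : nat) := odflt [::] (@unpickle (seq nat) n).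
  apply: (@negligibleS _ _ _ _ (\bigcup_n
      (H (E n) `\` \bigcup_j H (rcons (E n) j)))).
    by move=> x [s _ Hs]; exists (pickle s) => //; rewrite /E pickleK.
  by apply: negligible_bigcup => n; exact: NS.
pose D := H [::] `\` N.
pose next s x := xget 0%N [set j | H' s j x].
pose pre x k := iter k (fun s => rcons s (next s x)) [::].
have nextP s x : ~ N x -> H s x -> H' s (next s x) x.
  move=> Nx Hx; rewrite /next; case: xgetP => [j _ //|nH]; exfalso.
  apply: Nx; exists s => //; split=> //.
  by rewrite seqDU_bigcup_eq => -[j _ /nH].
have preH x k : D x -> H (pre x k) x.
  move=> [Hx Nx]; elim: k => [//|k IH] /=.
  by have := nextP _ _ Nx IH; exact: subset_seqDU.
have preE x k : mkseq (fun i => next (pre x i) x) k = pre x k.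
  by elim: k => [//|k IH]; rewrite mkseqS IH.
have size_pre x k : size (pre x k) = k by rewrite -preE size_mkseq.
(* The branch over [x] is measurable in [x]. *)
have mpre k s : measurable (D `&` [set x | pre x k = s]).
  elim: k s => [s|k IH s].
    have [->|s0] := eqVneq s [::].
      rewrite (_ : [set x | _] = setT); last by apply/seteqP; split.
      by rewrite setIT; exact: measurableD.
    rewrite (_ : [set x | _] = set0) ?setI0//.
    by apply/seteqP; split=> x //= /esym/eqP; rewrite (negbTE s0).
  case: (lastP s) => [|t j].
    rewrite (_ : [set x | _] = set0) ?setI0//.
    by apply/seteqP; split=> x //= /(congr1 size); rewrite size_rcons.
  rewrite (_ : _ `&` _ = D `&` [set x | pre x k = t] `&` H' t j).
    exact: measurableI.
  apply/seteqP; split=> [x [Dx /= /rcons_inj[<- <-]]|x [[Dx /= pt] Hj]].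
    split=> //; apply: nextP; [by case: Dx|exact: preH].
  split=> //=; rewrite pt; congr rcons.
  have nH : H' t (next t x) x by apply: nextP; [case: Dx|rewrite -pt; exact: preH].
  apply: (@trivIset_seqDU _ (fun j => H (rcons t j))) => //.
  by exists x.
have /choice[phi Hphi] x : exists z, D x -> forall k, V (pre x k) (f z).
  have [Dx|nD] := pselect (D x); last by exists (g0 x).
  (* A point over the [k]-th prefix lies in all the earlier sets as well. *)
  have /choice[w Hw] k : exists z, forall i, (i <= k)%N -> V (pre x i) (f z).
    have [_ _ _ Hne _] := HH (pre x k).
    have [x' [z [a [ak aV]]]] := Hne x (preH x k Dx).
    exists z => i ik; have [_] := aV i.
    by rewrite -(take_mkseq a ik) -{1}(size_pre x k) ak -preE take_mkseq// preE.
  pose u k := f (w k).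
  have uc : cauchy (u @ \oo).
    apply: cauchy_exP => e e0.
    have [k Vk] := sV (fun i => next (pre x i) x) e e0; rewrite preE in Vk.
    exists (u k); exists k => // n /= kn.
    by apply: Vk; apply: Hw.
  have /cvg_ex[/= l ul] : cvg (u @ \oo) by exact: cauchy_cvg.
  exists (g l) => _ k; rewrite gK.
  apply: (closed_cvg (V (pre x k))) ul => //.
  by exists k => // n /= kn; exact: Hw.
exists D, phi; split.
- exact: measurableD.
- move=> _ Y; rewrite mZ => -[B sB <-]; move: B sB; apply: smallest_sub.
    split=> [|B mB|B mB].
    + by rewrite !preimage_set0 setI0.
    + rewrite (_ : _ `&` _ = D `\` (D `&` phi @^-1` (f @^-1` B))).
        by apply: measurableD => //; exact: measurableD.
      apply/seteqP; split=> [x [Dx [_ nB]]|x [Dx nDB]]; split=> //.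
        by case.
      by split=> // Bx; apply: nDB.
    + by rewrite !preimage_bigcup setI_bigcupr; exact: bigcupT_measurable.
  (* The value lies in the open set [O] when some [V s] on its branch is
     included in [O]; there are countably many [s]. *)
  move=> O oO /=.
  rewrite (_ : _ `&` _ = \bigcup_k \bigcup_(s in [set s | V s `<=` O])
      (D `&` [set x | pre x k = s])).
    apply: bigcupT_measurable => k.
    rewrite bigcup_mkcond; apply: countable_bigcupT_measurable => // s.
    by case: ifP.
  apply/seteqP; split=> [x [Dx /= Ox]|x [k _ [s /= VO [Dx ps]]]]; last first.
    by split=> //=; apply: VO; rewrite -ps; exact: Hphi.
  have /nbhs_ballP[e /= e0 eO] := open_nbhs_nbhs (conj oO Ox).
  have [k Vk] := sV (fun i => next (pre x i) x) e e0; rewrite preE in Vk.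
  exists k => //; exists (pre x k) => //= y Vy; apply: eO.
  by apply: Vk => //; exact: Hphi.
- move=> x Dx; rewrite QE; exists (fun i => next (pre x i) x) => k; rewrite preE.
  split; last exact: Hphi.
  by have [_ _ + _ _] := HH (pre x k); apply; exact: preH.
- apply: negligibleS N0 => x [[z Qxz]] /not_andP[nH|/contrapT//]; exfalso.
  apply: nH; have [_ + _ _ _] := HH [::]; apply.
  by move: Qxz; rewrite QE => -[a aH]; exists z, a.
Qed.

End Selection.

(** * Realizing a subset of the relation by the full group *)

(** A closed network separates the points of a Hausdorff space. *)
Lemma standard_borel_separated (R : realType) d (X : measurableType d) :
  standard_borel (R := R) X ->
  exists C : nat -> set X, (forall n, measurable (C n)) /\
    forall x y, x <> y -> exists n, C n x /\ ~ C n y.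
Proof.
move=> [P [f [hP Pcount [g fK gK] mX]]].
have [W [cW nW]] := closed_network Pcount.
exists (fun n => f @^-1` W n); split=> [n|x y xy].
  rewrite mX; exists (W n) => //.
  rewrite -(setCK (W n)) -setTD; apply: sigma_algebraCD.
  by apply: sub_sigma_algebra; exact: closed_openC.
have /existsNP[A /existsNP[B /not_implyP[nA /not_implyP[nB AB]]]] :
    ~ cluster (nbhs (f x)) (f y).
  by move=> /hP /(can_inj fK).
have [j [Wx WA]] := nW _ _ nA.
exists j; split=> // /WA Ay.
by apply: AB; exists (f y); split=> //; exact: nbhs_singleton nB.
Qed.

Section FullGroup.
Context d (X : measurableType d) (R : realType)
  (mu : {sigma_finite_measure set X -> \bar R}) (E : set (X * X)).

(** A selection [phi] of [Q] need not be injective, but a selection [psi] of the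
    inverse of its graph is, and [phi] is injective on the range [B] of [psi].
    [B] is not null because the saturation of a null set is null, and the
    saturation of [B] contains almost all of the domain of [phi].  As [phi]
    moves every point, [B] has a non-null part disjoint from its image;
    exchanging this part with its image defines an involution in the full
    group. *)
Theorem full_group_meets (Q : set (X * X)) :
  standard_borel (R := R) X -> countable_measured_rel mu E ->
  measurable Q -> Q `<=` E -> (forall x, ~ Q (x, x)) ->
  ~ mu.-negligible [set x | exists y, Q (x, y)] ->
  exists phi B, [/\ full_group mu E phi, measurable B, ~ mu.-negligible B &
    forall x, B x -> Q (x, phi x)].
Proof.
move=> sX [[Erefl Esym _] _ _ Esat] mQ QE Qirr Qpos.
have [C [mC sepC]] := standard_borel_separated sX.
have [A [phi [mA mphi Qphi Anull]]] := measurable_selection mu id sX mQ.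
have mphiI Y : measurable Y -> measurable (A `&` phi @^-1` Y) by exact: mphi.
have Apos : ~ mu.-negligible A.
  move=> A0; apply: Qpos; apply: negligibleS (negligibleU A0 Anull) => x Qx.
  by have [Ax|nA] := pselect (A x); [left|right].
pose Q' := [set p : X * X | A p.2 /\ phi p.2 = p.1].
(* A graph is measurable because countably many sets separate points. *)
have mQ' : measurable Q'.
  rewrite (_ : Q' = (setT `*` A) `\`
      \bigcup_n ((~` C n) `*` (A `&` phi @^-1` C n))).
    apply: measurableD; first exact: measurableX.
    apply: bigcupT_measurable => n; apply: measurableX; last exact: mphiI.
    exact: measurableC.
  apply/seteqP; split=> [[y x] [/= Ax <-]|[y x] [[_ /= Ax] h]].
    by split=> // -[n _ [/= ? []]].
  split=> //=; apply: contrapT => /sepC[n [Cx nCy]]; apply: h.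
  by exists n.
have [D [psi [mD mpsi Qpsi Dnull]]] := measurable_selection mu id sX mQ'.
have mpsiI Y : measurable Y -> measurable (D `&` psi @^-1` Y) by exact: mpsi.
have psiA y : D y -> A (psi y) by move=> /Qpsi[].
have psiK y : D y -> phi (psi y) = y by move=> /Qpsi[].
have Ephi x : A x -> E (x, phi x) by move=> /Qphi /QE.
pose B := [set x | [/\ A x, D (phi x) & psi (phi x) = x]].
have mB : measurable B.
  rewrite (_ : B = (A `&` phi @^-1` D) `\`
      \bigcup_n ((A `&` phi @^-1` (D `&` psi @^-1` C n)) `\` C n)).
    apply: measurableD; first exact: mphiI.
    apply: bigcupT_measurable => n; apply: measurableD => //.
    by apply: mphiI; exact: mpsiI.
  apply/seteqP; split=> [x [Ax Dx px]|x [[Ax Dx] h]].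
    by split=> // -[n _ [[_ [_ /=]]]]; rewrite px.
  split=> //; apply: contrapT => /sepC[n [Cx nCy]]; apply: h.
  by exists n.
have Bpos : ~ mu.-negligible B.
  move=> /Esat B0.
  have D0 : mu.-negligible D.
    apply: negligibleS B0 => y Dy; exists (psi y).
      by rewrite /B /= psiK//; split=> //; exact: psiA.
    by rewrite -[X in (_, X)]psiK//; apply: Ephi; exact: psiA.
  apply: Apos; apply: negligibleS (Esat _ (negligibleU D0 Dnull)) => x Ax.
  exists (phi x); last by apply: Esym; exact: Ephi.
  have [Dx|nD] := pselect (D (phi x)); first by left.
  by right; split=> //; exists x.
(* [phi x] differs from [x], so some [C n] contains [x] but not [phi x]. *)
have [n Bn] : exists n, ~ mu.-negligible (B `&` C n `\` (A `&` phi @^-1` C n)).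
  apply/existsNP => H; apply: Bpos; apply: negligibleS (negligible_bigcup H).
  move=> x Bx; have [Ax _ _] := Bx.
  have /sepC[n [Cx nCp]] : x <> phi x by move=> xp; apply: (Qirr x); rewrite {2}xp; exact: Qphi.
  by exists n => //; split=> // -[].
set B1 := _ `\` _ in Bn.
have mB1 : measurable B1.
  by apply: measurableD; [exact: measurableI|exact: mphiI].
pose D1 := D `&` psi @^-1` B1.
have mD1 : measurable D1 by exact: mpsiI.
have B1A : B1 `<=` A by move=> x [[[]]].
have B1C : B1 `<=` C n by move=> x [[]].
have phi1 x : B1 x -> [/\ D1 (phi x), ~ C n (phi x) & psi (phi x) = x].
  move=> Bx; have [[[Ax Dx px] Cx] h] := Bx; split=> //.
    by split=> //=; rewrite px.
  by move=> Cp; apply: h.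
have psi1 y : D1 y -> [/\ B1 (psi y), ~ C n y & phi (psi y) = y].
  move=> [Dy By]; split=> //; last exact: psiK.
  by have [_ + _] := phi1 _ By; rewrite psiK.
pose Phi x := if `[< B1 x >] then phi x else if `[< D1 x >] then psi x else x.
have PhiB x : B1 x -> Phi x = phi x by rewrite /Phi; case: asboolP.
have PhiD x : D1 x -> Phi x = psi x.
  move=> Dx; rewrite /Phi; case: asboolP => [/B1C Cx|_].
    by have [_] := psi1 _ Dx.
  by case: asboolP.
have PhiN x : ~ B1 x -> ~ D1 x -> Phi x = x.
  by rewrite /Phi; case: asboolP => // _ _; case: asboolP.
have PhiK : cancel Phi Phi.
  move=> x; have [Bx|nB] := pselect (B1 x).
    by have [Dx _ px] := phi1 _ Bx; rewrite (PhiB _ Bx) PhiD.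
  have [Dx|nD] := pselect (D1 x); last by rewrite !PhiN.
  by have [Bx _ px] := psi1 _ Dx; rewrite (PhiD _ Dx) PhiB.
have EPhi x : E (x, Phi x).
  have [Bx|nB] := pselect (B1 x); first by rewrite PhiB//; apply: Ephi; exact: B1A.
  have [Dx|nD] := pselect (D1 x); last by rewrite PhiN.
  have [Bx _ px] := psi1 _ Dx; rewrite PhiD//; apply: Esym.
  by rewrite -[X in (_, X)]px; apply: Ephi; exact: B1A.
have mPhi : measurable_fun setT Phi.
  move=> _ Y mY; rewrite setTI (_ : _ @^-1` _ = (B1 `&` (A `&` phi @^-1` Y)) `|`
      (D1 `&` (D `&` psi @^-1` Y)) `|` (Y `\` (B1 `|` D1))).
    apply: measurableU; first apply: measurableU.
    - by apply: measurableI => //; exact: mphiI.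
    - by apply: measurableI => //; exact: mpsiI.
    - by apply: measurableD => //; exact: measurableU.
  apply/seteqP; split=> [x /= Yx|x [[[Bx [_ Yx]]|[Dx [_ Yx]]]|[Yx]]].
  - have [Bx|nB] := pselect (B1 x).
      left; left; split=> //; split; first exact: B1A.
      by rewrite /= -PhiB.
    have [Dx|nD] := pselect (D1 x).
      left; right; split=> //; split; first by case: Dx.
      by rewrite /= -PhiD.
    by right; rewrite PhiN// in Yx; split=> // -[].
  - by rewrite /preimage/= PhiB.
  - by rewrite /preimage/= PhiD.
  - by move=> /not_orP[nB nD]; rewrite /preimage/= PhiN.
(* The inverse image of [Y] under a map with graph in [E] lies in the saturation
   of [Y]; this makes the involution nonsingular. *)
have Phi0 Y : measurable Y -> mu Y = 0%E -> mu (Phi @^-1` Y) = 0%E.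
  move=> mY /(negligibleP mu mY) /Esat Y0; apply/negligibleP.
    by rewrite -[X in measurable X]setTI; exact: mPhi.
  by apply: negligibleS Y0 => x Yx; exists (Phi x) => //; exact: Esym.
exists Phi, B1; split=> //.
- split; last by apply: aeW.
  split; first by exists Phi.
  move=> Y mY; split; last exact: Phi0.
  move=> /Phi0; rewrite -comp_preimage (_ : Phi \o Phi = id).
    by apply; rewrite -[X in measurable X]setTI; exact: mPhi.
  by apply/funext.
- by move=> x Bx; rewrite PhiB//; apply: Qphi; exact: B1A.
Qed.

End FullGroup.

(** * Comparing two Radon-Nikodym cocycles *)

Section Comparable.
Context d (X : measurableType d) (R : realType).
Variables m n : {sigma_finite_measure set X -> \bar R}.

(** The second condition says that [m] is at most [a] times [n] on [A]; it is
    stated for integrals, the form in which it is applied to cocycles. *)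
Definition comparable_on (a : R) (A : set X) : Prop :=
  forall C, measurable C -> C `<=` A -> (n C <= a%:E * m C)%E /\
    forall g : X -> \bar R, (forall x, 0 <= g x)%E -> measurable_fun C g ->
      (\int[m]_(x in C) g x <= a%:E * \int[n]_(x in C) g x)%E.

(** On a piece of finite measure [n] has a density with respect to [m], which is
    positive and finite almost everywhere for [n]; it is bounded above and
    below on some subset of positive measure. *)
Lemma comparable_subset B : n `<< m -> measurable B -> n B <> 0%E ->
  exists a A, [/\ 1 <= a, measurable A, A `<=` B,
    n A <> 0%E & (n A < +oo)%E /\ comparable_on a A].
Proof.
move=> /null_content_dominatesP nm mB nB.
have [F FT /all_and2[mF Foo]] := sigma_finiteT n.
have [i nBi] : exists i, n (B `&` F i) <> 0%E.
  apply/existsNP => H; apply: nB; apply/negligibleP => //.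
  have : n.-negligible (\bigcup_i (B `&` F i)).
    apply: negligible_bigcup => i; apply/negligibleP; last exact: contrapT (H i).
    exact: measurableI.
  by rewrite -setI_bigcupr -FT setIT.
pose nF : {finite_measure set X -> \bar R} := mfrestr (mF i) (Foo i).
have nFE C : C `<=` F i -> nF C = n C.
  by move=> CF; rewrite /nF/= /mfrestr /mrestr setIidl.
have nFm : nF `<< m.
  apply/null_content_dominatesP => C mC C0.
  apply: (@subset_measure0 _ _ _ n _ C) => //; last exact: nm.
  exact: measurableI.
pose h := Radon_Nikodym_SigmaFinite.f nF m.
have h0 x : (0 <= h x)%E by exact: Radon_Nikodym_SigmaFinite.f_ge0.
have hfin x : h x \is a fin_num by exact: Radon_Nikodym_SigmaFinite.f_fin_num.
have mh : measurable_fun setT h.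
  by apply: measurable_int (Radon_Nikodym_SigmaFinite.f_integrable nFm).
have hE := Radon_Nikodym_SigmaFinite.f_integral nFm.
pose A k := B `&` F i `&` [set x | (k.+1%:R^-1)%:E <= h x]%E
  `&` [set x | h x <= k.+1%:R%:E]%E.
have mA k : measurable (A k).
  apply: measurableI; first apply: measurableI.
  - exact: measurableI.
  - by rewrite -[X in measurable X]setTI; exact: emeasurable_fun_c_infty.
  - by rewrite -[X in measurable X]setTI; exact: emeasurable_fun_infty_c.
have AF k : A k `<=` F i by move=> x [[[]]].
have [k nA] : exists k, n (A k) <> 0%E.
  apply/existsNP => H; apply: nBi.
  pose Z := B `&` F i `&` h @^-1` [set 0%E].
  have mZ : measurable Z.
    apply: measurableI; first exact: measurableI.
    by rewrite -[X in measurable X]setTI; exact: mh.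
  have nZ : n Z = 0%E.
    rewrite -nFE; last by move=> x [[]].
    by rewrite hE//; apply: integral0_eq => x [].
  apply/negligibleP; first exact: measurableI.
  apply: (@negligibleS _ _ _ _ (Z `|` \bigcup_k A k)); last first.
    apply: negligibleU; first exact/negligibleP.
    by apply: negligible_bigcup => k; apply/negligibleP => //; exact: contrapT (H k).
  move=> x [Bx Fx]; have [hx0|hx0] := eqVneq (h x) 0%E; first by left.
  right; have r0 : 0 < fine (h x).
    by rewrite fine_gt0// lt0e hx0 h0/= -ge0_fin_numE.
  have [k1 k1E] := ltr_add_invr r0; rewrite add0r in k1E.
  pose k := maxn k1 (Num.truncn (fine (h x))).
  exists k => //; split; first split=> //=.
    rewrite -(fineK (hfin x)) lee_fin; apply: le_trans (ltW k1E).
    by rewrite lef_pV2 ?posrE ?ltr0n// ler_nat ltnS leq_maxl.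
  rewrite /= -(fineK (hfin x)) lee_fin.
  apply: (le_trans (ltW (truncnS_gt _))).
  by rewrite ler_nat ltnS leq_maxr.
exists k.+1%:R, (A k); split=> //.
- by rewrite ler1n.
- by move=> x [[[]]].
- split.
    apply: le_lt_trans (Foo i); apply: le_measure; rewrite ?inE//; exact: AF.
  move=> C mC CA; have CF := subset_trans CA (@AF k).
  have mhC : measurable_fun C h by exact: measurable_funTS.
  split.
    rewrite -(nFE _ CF) hE// -integral_cst//.
    by apply: ge0_le_integral => //= x /CA[].
  move=> g g0 mg.
  rewrite (@eq_measure_integral _ _ _ C nF n); last first.
    by move=> D _ DC; apply/esym/nFE; exact: subset_trans DC CF.
  rewrite -(Radon_Nikodym_SigmaFinite.change_of_variables nFm)//.
  rewrite -ge0_integralZl//; last 2 first.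
  - exact: emeasurable_funM.
  - by move=> x _; apply: mule_ge0.
  apply: ge0_le_integral => //.
    by apply: emeasurable_funM => //; exact: emeasurable_funM.
  move=> x /CA[[_ /= hx] _].
  rewrite muleCA -[leLHS]mule1; apply: lee_wpmul2l => //.
  have {}hx : k.+1%:R^-1 <= fine (h x) by rewrite -lee_fin fineK.
  rewrite -[X in (_ * X)%E](fineK (hfin x)) -EFinM lee_fin.
  by rewrite -ler_pdivrMl ?ltr0n// mulr1.
Qed.

End Comparable.

Section CocycleComparison.
Context d (X : measurableType d) (R : realType).
Variables m n : {sigma_finite_measure set X -> \bar R}.
Variable E : set (X * X).

Lemma cocycle_diag (nu : set X -> \bar R) (delta : X -> X -> R) x :
  Defs.equivalence_rel E -> RN_cocycle nu E delta -> delta x x = 1.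
Proof.
move=> [Erefl _ _] [_ dpos dmul _].
apply: (mulfI (lt0r_neq0 (dpos x x (Erefl x)))).
by rewrite mulr1 -dmul.
Qed.

(** Otherwise an element [phi] of the full group maps some non-null [B] in [A]
    into [A] with [dn (phi x) x > M * dm (phi x) x].  Integrating over [B] gives
    [n (phi B) >= (M / a) * m (phi B)], and [m (phi B) >= n (phi B) / a]; so
    [M <= a * a]. *)
Lemma cocycle_ratio_bound (dm dn : X -> X -> R) (a M : R) (A : set X) :
  standard_borel (R := R) X -> countable_measured_rel m E ->
  equiv_measure m n -> RN_cocycle m E dm -> RN_cocycle n E dn ->
  measurable A -> (n A < +oo)%E -> comparable_on m n a A ->
  1 <= a -> a * a < M ->
  m.-negligible [set x | exists y,
    [/\ A x, A y, E (x, y) & M * dm y x < dn y x]].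
Proof.
move=> sX Ecm eqv RNm RNn mA Aoo cmp a1 aM.
have a0 : 0 < a by exact: lt_le_trans a1.
have M0 : 0 < M by apply: lt_trans aM; exact: mulr_gt0.
have [Eeq _ mE _] := Ecm; have [_ Esym _] := Eeq.
have [mdm dm0 _ dmphi] := RNm; have [mdn dn0 _ dnphi] := RNn.
pose Q := [set p : X * X | [/\ A p.1, A p.2, E (p.1, p.2) &
  M * dm p.2 p.1 < dn p.2 p.1]].
have mQ : measurable Q.
  pose g (p : X * X) := dn p.1 p.2 - M * dm p.1 p.2.
  have mg : measurable_fun E g.
    by apply: measurable_funB => //; apply: measurable_funM.
  have mG : measurable (E `&` g @^-1` `]0, +oo[) by apply: mg.
  have mS : measurable ([set: X * X] `&`
      (fun p : X * X => (p.2, p.1)) @^-1` (E `&` g @^-1` `]0, +oo[)).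
    by apply: measurable_swap.
  rewrite (_ : Q = (A `*` A) `&` ([set: X * X] `&`
      (fun p : X * X => (p.2, p.1)) @^-1` (E `&` g @^-1` `]0, +oo[))).
    by apply: measurableI => //; exact: measurableX.
  apply/seteqP; split=> [[x y] [/= Ax Ay Exy lt]|[x y] [[/= Ax Ay] [_ [/= Exy lt]]]].
    split=> //; split=> //; split; first exact: Esym.
    by rewrite /preimage/= in_itv/= andbT /g subr_gt0.
  split=> //=; first exact: Esym.
  by move: lt; rewrite in_itv/= andbT /g subr_gt0.
apply: contrapT => Qpos.
have [|||phi [B [fgphi mB Bpos Qphi]]] := full_group_meets sX Ecm mQ.
- by move=> [x y] [].
- move=> x [_ _ _ /=].
  rewrite (cocycle_diag x Eeq RNm) (cocycle_diag x Eeq RNn) mulr1 ltNge => /negP; apply.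
  by apply: le_trans (ltW aM); rewrite -[leLHS]mulr1 ler_pM.
- apply: contra_not Qpos; apply: negligibleS => x [y [Ax Ay Exy lt]].
  by exists y.
have fgn := full_group_equiv eqv fgphi.
have [[[psi [phiK psiK mphi mpsi]] ns] _] := fgn.
have BA : B `<=` A by move=> x /Qphi[].
have imE : phi @` B = psi @^-1` B.
  apply/seteqP; split=> [_ [x Bx <-]|y By]; first by rewrite /preimage/= phiK.
  by exists (psi y).
have mim : measurable (phi @` B).
  by rewrite imE -[X in measurable X]setTI; exact: mpsi.
have imA : phi @` B `<=` A by move=> _ [x /Qphi[_ ? _ _] <-].
have im0 : (0 < n (phi @` B))%E.
  rewrite lt0e measure_ge0 andbT; apply/eqP => /(ns _ mim).
  rewrite imE -comp_preimage (_ : psi \o phi = id); last exact/funext.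
  by move=> /(negligibleP n mB)/(equiv_measure_negligible _ eqv).
have imoo : (n (phi @` B) < +oo)%E.
  by apply: le_lt_trans Aoo; apply: le_measure; rewrite ?inE.
have mphiE (dl : X -> X -> R) : measurable_fun E (fun p : X * X => dl p.1 p.2) ->
    measurable_fun B (fun x => dl (phi x) x).
  move=> mdl; apply: (@measurable_comp _ _ _ _ _ _ E (fun p : X * X => dl p.1 p.2) _
    (fun x => (phi x, x))) => //.
    by move=> _ [x Bx <-]; apply: Esym; have [] := Qphi x Bx.
  by apply: measurable_funTS; apply: measurable_fun_pair.
pose g x := `|dm (phi x) x|%:E.
have g0 x : (0 <= g x)%E by rewrite lee_fin.
have mg : measurable_fun B g.
  by apply/measurable_EFinP; apply: measurableT_comp => //; exact: mphiE.
have gE x : B x -> g x = (dm (phi x) x)%:E.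
  move=> /Qphi[_ _ Exp _]; rewrite /g gtr0_norm//.
  by apply: dm0; exact: Esym.
have h1 : (m (phi @` B) <= a%:E * \int[n]_(x in B) g x)%E.
  rewrite dmphi// (_ : (\int[m]_(x in B) _)%E = (\int[m]_(x in B) g x)%E).
    by have [_ /(_ _ g0 mg)] := cmp B mB BA.
  by apply: eq_integral => x; rewrite inE => /gE.
have h2 : (M%:E * \int[n]_(x in B) g x <= n (phi @` B))%E.
  rewrite dnphi// -ge0_integralZl//; last by rewrite lee_fin ltW.
  apply: ge0_le_integral => //.
  - by move=> x _; rewrite mule_ge0// lee_fin ltW.
  - by apply: emeasurable_funM.
  - by apply/measurable_EFinP; exact: mphiE.
  - move=> x Bx; rewrite gE// -EFinM lee_fin ltW//.
    by have [] := Qphi x Bx.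
have [h3 _] := cmp _ mim imA.
have : (M%:E * n (phi @` B) <= (a * a)%:E * n (phi @` B))%E.
  apply: (@le_trans _ _ (M%:E * (a%:E * (a%:E * \int[n]_(x in B) g x)))%E).
    apply: lee_wpmul2l; first by rewrite lee_fin ltW.
    apply: (le_trans h3); apply: lee_wpmul2l => //.
    by rewrite lee_fin ltW.
  rewrite muleCA [X in (_ * X)%E]muleCA muleA -EFinM.
  by apply: lee_wpmul2l => //; rewrite lee_fin ltW// mulr_gt0.
have fin : n (phi @` B) \is a fin_num by rewrite ge0_fin_numE// ltW.
rewrite -(fineK fin) -!EFinM lee_fin leNgt ltr_pM2r ?aM//.
by rewrite fine_gt0// im0.
Qed.

End CocycleComparison.

Lemma cocycle_inv (R : realType) d (X : measurableType d) (E : set (X * X))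
    (nu : set X -> \bar R) (delta : X -> X -> R) x y :
  Defs.equivalence_rel E -> RN_cocycle nu E delta -> E (x, y) ->
  delta x y = (delta y x)^-1.
Proof.
move=> Eeq RNd Exy; have [_ Esym _] := Eeq; have [_ dpos dmul _] := RNd.
have dyx0 := lt0r_neq0 (dpos y x (Esym _ _ Exy)).
apply: (mulIf dyx0); rewrite mulVf// -dmul//; last exact: Esym.
exact: cocycle_diag RNd.
Qed.

Lemma ln_dist_le (R : realType) (p q M : R) : 0 < p -> 0 < q -> 0 < M ->
  p <= M * q -> p^-1 <= M * q^-1 -> `|ln q - ln p| <= ln M.
Proof.
move=> p0 q0 M0 pq qp.
have h1 : ln p <= ln M + ln q by rewrite -lnM ?posrE// ler_ln ?posrE// mulr_gt0.
have h2 : - ln p <= ln M - ln q.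
  rewrite -!lnV ?posrE// -lnM ?posrE ?invr_gt0//.
  by rewrite ler_ln ?posrE ?mulr_gt0 ?invr_gt0.
by rewrite ler_norml; apply/andP; split; lra.
Qed.

(** * The associated flow along an orbit of the relation *)

Section FlowUnder.
Context {R : realType} (Z : Type) (T : Z -> Z) (xi : Z -> R)
  (G : R -> Z * R -> Z * R).
Hypothesis GT : flow_under T xi G.
Hypothesis xi0 : forall z, 0 < xi z.

Lemma under_graph_base z : under_graph xi (z, 0).
Proof. by rewrite /under_graph/= lexx xi0. Qed.

(** A point at height [u] is the point at height [0] after time [u]. *)
Lemma flow_under_height z z' t u u' : G t (z, 0) = (z', 0) ->
  0 <= u < xi z -> 0 <= u' < xi z' -> G (t + u' - u) (z, u) = (z', u').
Proof.
have [Gug G0 GD Gup GTop] := GT.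
move=> Gt /andP[u0 uz] /andP[u'0 u'z].
have -> : (z, u) = G u (z, 0).
  by rewrite Gup ?add0r//.
rewrite -GD; last exact: under_graph_base.
rewrite subrK addrC GD; last exact: under_graph_base.
by rewrite Gt Gup ?add0r.
Qed.

End FlowUnder.

Section OrbitFlow.
Context {R : realType} d (X : measurableType d) d0 (X0 : measurableType d0).
Variables (m : {sigma_finite_measure set X -> \bar R}) (E : set (X * X)).
Variables (delta : X -> X -> R) (pi : X -> X0) (xi : X0 -> R) (T : X0 -> X0).
Variable G : R -> X0 * R -> X0 * R.

(** If [ln (delta y x)] is zero, [x] and [y] are related by the unimodular part
    and invariant sets do not separate them, hence [pi x = pi y].  If it is
    positive it is at least the first jump [xi (pi x)]; the flow crosses the
    fiber over [pi x] during this jump and arrives over [pi x'], from which a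
    smaller value is left.  Jumps exceed [e], so finitely many suffice.
    Negative values follow by exchanging [x] and [y].  The exceptional set is
    saturated, so that almost everywhere properties hold along whole orbits. *)
Lemma orbit_flow :
  countable_measured_rel m E -> RN_cocycle m E delta -> lacunary E delta ->
  ergodic_decomposition m (unimodular_part E delta) pi ->
  (forall z, 0 < xi z) ->
  {ae m, forall x, log_jumps E delta x (xi (pi x)) /\
                   lbound (log_jumps E delta x) (xi (pi x))} ->
  {ae m, forall x, forall x', E (x, x') ->
           ln (delta x' x) = xi (pi x) -> T (pi x) = pi x'} ->
  flow_under T xi G ->
  exists2 N, m.-negligible N & forall x y, ~ N x -> E (x, y) ->
    G (ln (delta y x)) (pi x, 0) = (pi y, 0).
Proof.
move=> Ecm RNd [e e0 lac] [sX0 mpi Cinv _] xi0 jump Tpi GT.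
have [Eeq _ _ Esat] := Ecm; have [Erefl Esym Etrans] := Eeq.
have [_ dpos dmul _] := RNd.
have [C [mC sepC]] := standard_borel_separated sX0.
have /choice[A HA] n : exists A, [/\ measurable A,
    invariant_set (unimodular_part E delta) A &
    {ae m, forall x, C n (pi x) <-> A x}] by exact: Cinv.
have ACae : {ae m, forall x n, C n (pi x) <-> A n x}.
  by apply: ae_foralln => n; have [] := HA n.
pose good x := [/\ forall n, C n (pi x) <-> A n x,
  log_jumps E delta x (xi (pi x)) /\
                   lbound (log_jumps E delta x) (xi (pi x)) &
  forall x', E (x, x') -> ln (delta x' x) = xi (pi x) -> T (pi x) = pi x'].
have good_ae : m.-negligible [set x | ~ good x].
  apply: negligibleS (negligibleU ACae (negligibleU jump Tpi)) => x ngx.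
  apply: contrapT => /not_orP[/contrapT ? /not_orP[/contrapT ? /contrapT ?]].
  by apply: ngx.
pose N := saturation E [set x | ~ good x].
have goodN x y : ~ N x -> E (x, y) -> good y.
  move=> Nx Exy; apply: contrapT => ngy; apply: Nx; exists y => //.
  exact: Esym.
have N_inv x y : ~ N x -> E (x, y) -> ~ N y.
  move=> Nx Exy [z ngz Ezy]; apply: Nx; exists z => //.
  by apply: Etrans Ezy _; exact: Esym.
have ln_mul x y z : E (x, y) -> E (y, z) ->
    ln (delta z x) = ln (delta z y) + ln (delta y x).
  move=> Exy Eyz; rewrite (dmul z y x); [|exact: Esym..].
  by rewrite lnM// posrE; apply: dpos; exact: Esym.
have ln_diag x : ln (delta x x) = 0 by rewrite (cocycle_diag x Eeq RNd) ln1.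
have [Gug G0 GD Gup GTop] := GT.
have base z : under_graph xi (z, 0) by exact: under_graph_base.
have zero x y : ~ N x -> E (x, y) -> ln (delta y x) = 0 -> pi x = pi y.
  move=> Nx Exy t0; apply: contrapT => /sepC[n [Cx nCy]].
  apply: nCy; have [gy _ _] := goodN _ _ Nx Exy.
  have [gx _ _] := goodN _ _ Nx (Erefl x).
  apply/gy; have [_ Ainv _] := HA n; apply: (Ainv x y); last exact/gx.
  split=> //=; have := ln_mul _ _ _ Exy (Esym _ _ Exy).
  rewrite ln_diag t0 addr0 => /esym/eqP; rewrite ln_eq0; last exact: dpos.
  by move/eqP.
(* Induction on the number of jumps. *)
have pos k x y : ~ N x -> E (x, y) -> 0 <= ln (delta y x) <= k%:R * e ->
    G (ln (delta y x)) (pi x, 0) = (pi y, 0).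
  elim: k x y => [|k IH] x y Nx Exy /andP[t0 tk].
    have {tk}t0 : ln (delta y x) = 0.
      by apply/eqP; rewrite eq_le t0 andbT; move: tk; rewrite mul0r.
    by rewrite t0 G0// (zero x y).
  have [y0|tn0] := eqVneq (ln (delta y x)) 0; first by rewrite y0 G0// (zero x y).
  have [_ [[x' [Ex'x jpos] jE] jmin] Tx] := goodN _ _ Nx (Erefl x).
  have Exx' := Esym _ _ Ex'x.
  have xit : xi (pi x) <= ln (delta y x).
    apply: jmin; exists y => //; split; first exact: Esym.
    by rewrite lt0r tn0.
  have exi : e < xi (pi x).
    have [j0|] := lac _ _ Ex'x; first by move: jpos; rewrite j0 ltxx.
    by rewrite gtr0_norm// jE.
  have Ex'y := Etrans _ _ _ Ex'x Exy.
  have tE := ln_mul _ _ _ Exx' Ex'y.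
  have Gjump : G (xi (pi x)) (pi x, 0) = (pi x', 0).
    by have := GTop (pi x) 0; rewrite lexx xi0 subr0 => ->//; rewrite (Tx x').
  rewrite tE jE (GD _ _ _ (base _)) Gjump; apply: IH => //; first exact: N_inv Exx'.
  have -> : ln (delta y x') = ln (delta y x) - xi (pi x).
    by rewrite tE jE addrK.
  rewrite subr_ge0 xit/= lerBlDr; apply: (le_trans tk).
  by rewrite -natr1 mulrDl mul1r lerD2l ltW.
exists N; first exact: Esat.
move=> x y Nx Exy.
have archi t : 0 <= t -> t <= (Num.truncn (t / e)).+1%:R * e.
  by move=> t0; rewrite -ler_pdivrMr// ltW// truncnS_gt.
have [t0|t0] := leP 0 (ln (delta y x)).
  by apply: (pos _ x y Nx Exy); rewrite t0/=; exact: archi.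
have tE := ln_mul _ _ _ Exy (Esym _ _ Exy).
have t'E : ln (delta x y) = - ln (delta y x).
  by apply/eqP; rewrite -addr_eq0 -tE ln_diag.
have t'0 : 0 <= ln (delta x y) by rewrite t'E oppr_ge0 ltW.
have := pos _ _ _ (N_inv _ _ Nx Exy) (Esym _ _ Exy).
move=> /(_ (Num.truncn (ln (delta x y) / e)).+1); rewrite t'0/= archi// => /(_ isT) <-.
by rewrite -(GD _ _ _ (base _)) t'E subrr G0.
Qed.

End OrbitFlow.

(** * Conjugate flows *)

Section Fibers.
Context {R : realType}.

Lemma lebesgue_measure_shift (A : set R) (t : R) : measurable A ->
  pushforward lebesgue_measure (fun r : measurableTypeR R => r + t : measurableTypeR R) A = lebesgue_measure A.
Proof.
move=> mA; apply/esym/lebesgue_measure_unique => //=.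
- exact: (@measurable_funD _ R R setT id (cst t)).
- move=> _ _ [[a b]] _ <-.
  rewrite /pushforward/= (_ : _ @^-1` _ = [set` `]a - t, b - t]]); last first.
    by apply/seteqP; split=> r /=; rewrite !in_itv/= ltrBlDr lerBrDr.
  rewrite !lebesgue_measure_itv/= !lte_fin ltrD2r.
  case: ifP => // _; rewrite -!EFinB; congr EFin.
  by rewrite opprD opprK addrACA addNr addr0.
Qed.

(** Both iterated integrals of the indicator of [Q] compute its product
    measure. *)
Lemma ae_xsection_null d (X : measurableType d) d' (Y : measurableType d')
    (mu : {sigma_finite_measure set X -> \bar R})
    (nu : {sigma_finite_measure set Y -> \bar R}) (Q : set (X * Y)) :
  measurable Q -> (forall y, mu (ysection Q y) = 0%E) ->
  {ae mu, forall x, nu (xsection Q x) = 0%E}.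
Proof.
move=> mQ Q0; apply/(@ge0_integral_eq0_ae _ _ _ mu (fun x => nu (xsection Q x))) => //.
  exact: measurable_fun_xsection.
transitivity ((mu \x nu)%E Q) => //.
transitivity ((mu \x^ nu)%E Q).
  apply: product_measure_unique => // A B mA mB.
  exact: product_measure2E.
by apply: integral0_eq => y _ /=.
Qed.

End Fibers.

Section Conjugacy.
Context {R : realType} d (Y : measurableType d).
Variables (nu : {sigma_finite_measure set Y -> \bar R}) (F : R -> Y -> Y).
Context (W : Type) (G : R -> W -> W) (Phi : Y -> W) (Psi : W -> Y).

(** [Phi] is injective only off a null set, and [F t w] may fall into that set
    when [t] depends on [w].  But the orbits of [F t w] and [w'] have the same
    image under [Phi] at all times; for almost every time [r] both points
    are off the null set, so that the orbits coincide at time [r] and therefore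
    at time [0]. *)
Lemma flow_eq_of_conj : measurable_flow nu F ->
  {ae nu, forall y, Psi (Phi y) = y} ->
  {ae nu, forall y, forall t, Phi (F t y) = G t (Phi y)} ->
  exists2 N, nu.-negligible N & forall w w' t, ~ N w -> ~ N w' ->
    (forall r, G (r + t) (Phi w) = G r (G t (Phi w))) ->
    G t (Phi w) = Phi w' -> F t w = w'.
Proof.
move=> [F0 FD Fns mF] [N [mN N0 PK]] eqv.
pose Q : set (Y * R) := (fun p => F p.2 p.1) @^-1` N.
have mQ : measurable Q by rewrite -[X in measurable X]setTI; exact: mF.
have Qae : {ae nu, forall y, lebesgue_measure (xsection Q y) = 0%E}.
  apply: ae_xsection_null => // t.
  have [_ /(_ _ mN)[_]] := Fns t; move/(_ N0).
  by rewrite (_ : ysection Q t = F t @^-1` N)//; apply/seteqP; split=> y;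
    rewrite /ysection/= inE.
exists (~` [set y | lebesgue_measure (xsection Q y) = 0%E] `|`
    ~` [set y | forall t, Phi (F t y) = G t (Phi y)]).
  exact: negligibleU.
move=> w w' t /not_orP[/contrapT /= w0 /contrapT /= wE] /not_orP[/contrapT /= w'0 /contrapT /= w'E].
move=> GD Gt.
have mX y : measurable (xsection Q y) by exact: measurable_xsection.
have shift0 : lebesgue_measure ((fun r : R => r + t) @^-1` xsection Q w) = 0%E.
  by have := lebesgue_measure_shift t (mX w); rewrite w0.
have [r /not_orP[rw rw']] : exists r,
    ~ ((fun r : R => r + t) @^-1` xsection Q w `|` xsection Q w') r.
  apply/existsNP => H.
  have mS : measurable ((fun r : R => r + t) @^-1` xsection Q w).
    rewrite -[X in measurable X]setTI.
    by apply: (@measurable_funD _ R R setT id (cst t)).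
  pose L : {measure set (measurableTypeR R) -> \bar R} := lebesgue_measure.
  have /negligibleP : L.-negligible [set` `[(0 : R), 1]].
    have nU : L.-negligible ((fun r : R => r + t) @^-1` xsection Q w `|` xsection Q w').
      by apply: negligibleU; apply/negligibleP;
        [exact: mS|exact: shift0|exact: mX|exact: w'0].
    apply: negligibleS nU.
    by move=> r _; exact: contrapT (H r).
  have L1 : L [set` `[(0 : R), 1]] = 1%E.
    have := @lebesgue_measure_itv R `[(0 : R), 1]; rewrite /= lte_fin ltr01.
    by rewrite oppr0 adde0; exact.
  by move=> /(_ (measurable_itv _)) /(etrans (esym L1)) /eqP; rewrite eqe oner_eq0.
have FE y s : ~ xsection Q y s -> Psi (Phi (F s y)) = F s y.
  move=> ys; apply: contrapT => nP; apply: ys; rewrite /xsection/= inE.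
  exact: PK.
have : F (r + t) w = F r w'.
  by rewrite -(FE _ _ rw) -(FE _ _ rw') wE w'E GD Gt.
rewrite FD => /(congr1 (F (- r))).
by rewrite -!FD ?addrA !addNr add0r F0.
Qed.
End Conjugacy.

Section FlowSpace.
Context {R : realType} d (X : measurableType d) d0 (X0 : measurableType d0)
  d' (Y : measurableType d').
Variables (m : {sigma_finite_measure set X -> \bar R})
  (nu : {sigma_finite_measure set Y -> \bar R})
  (pi : X -> X0) (xi : X0 -> R).
Hypotheses (mpi : measurable_fun setT pi) (mxi : measurable_fun setT xi).

Let mu0 := pushforward m pi.
Let la := fun C : set (X0 * R) =>
  (mu0 \x lebesgue_measure)%E (C `&` under_graph xi).

(** The inverse image, under the projection of [X] onto the base of the flow, of
    the part of [C] under the graph of [xi]. Integrating its fibers over [X]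
    avoids the image measure on the base, which need not be sigma-finite. *)
Definition lift_to_base (C : set (X0 * R)) : set (X * R) :=
  [set p | (C `&` under_graph xi) (pi p.1, p.2)].

Lemma measurable_under_graph : measurable (under_graph xi).
Proof.
have -> : under_graph xi = (snd @^-1` `[0, +oo[) `&`
    ((fun p : X0 * R => xi p.1 - p.2) @^-1` `]0, +oo[).
  apply/seteqP; split=> -[z u] /=; rewrite /under_graph/= !in_itv/= !andbT subr_gt0.
    by move=> /andP.
  by move=> ?; apply/andP.
apply: measurableI; rewrite -[X in measurable X]setTI.
  exact: measurable_snd.
by apply: measurable_funB => //; exact: measurableT_comp.
Qed.

Lemma measurable_lift C : measurable C -> measurable (lift_to_base C).
Proof.
move=> mC; rewrite -[X in measurable X]setTI.
have mf : measurable_fun setT (fun p : X * R => (pi p.1, p.2)).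
  by apply: measurable_fun_pair => //; exact: measurableT_comp.
apply: mf => //; apply: measurableI => //; exact: measurable_under_graph.
Qed.

Lemma la_null C : measurable C ->
  la C = 0%E <->
  {ae m, forall x, lebesgue_measure (xsection (lift_to_base C) x) = 0%E}.
Proof.
move=> mC.
have mCu : measurable (C `&` under_graph xi).
  apply: measurableI => //; exact: measurable_under_graph.
have mh : measurable_fun setT
    (fun x => lebesgue_measure (xsection (lift_to_base C) x)).
  by apply: measurable_fun_xsection; exact: measurable_lift.
have laE : la C = (\int[m]_x lebesgue_measure (xsection (lift_to_base C) x))%E.
  rewrite /la /product_measure1 /mu0 ge0_integral_pushforward//=.
  exact: measurable_fun_xsection.
by rewrite laE; exact: ge0_integral_eq0_ae.
Qed.

Variables (Phi : Y -> X0 * R) (Psi : X0 * R -> Y).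
Hypotheses (mPhi : measurable_fun setT Phi) (mPsi : measurable_fun setT Psi).
Hypothesis PhiK : {ae nu, forall y, Psi (Phi y) = y}.
Hypothesis Phi_null : forall C, measurable C ->
  (nu (Phi @^-1` C) = 0%E <-> la C = 0%E).

(** [Phi] carries the null sets of the flow space to those of [Y], and
    [Psi] inverts it up to a null set. *)
Lemma conj_null (D : set Y) : measurable D ->
  nu D = 0%E <-> {ae m, forall x,
    lebesgue_measure (xsection (lift_to_base (Psi @^-1` D)) x) = 0%E}.
Proof.
move=> mD.
have mPD : measurable (Psi @^-1` D).
  by rewrite -[X in measurable X]setTI; exact: mPsi.
have mPPD : measurable (Phi @^-1` (Psi @^-1` D)).
  by rewrite -[X in measurable X]setTI; exact: mPhi.
rewrite -la_null// -Phi_null//.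
split=> /(negligibleP nu) => [/(_ mD) D0|/(_ mPPD) D0]; apply/negligibleP => //;
  apply: negligibleS (negligibleU D0 PhiK) => y Dy.
  have [yE|?] := pselect (Psi (Phi y) = y); last by right.
  by left; rewrite -yE.
have [yE|?] := pselect (Psi (Phi y) = y); last by right.
by left; rewrite /preimage/= yE.
Qed.

End FlowSpace.

(** * Transferring Property B to the relation *)

Lemma flow_between_fibers (R : realType) d' (Y : measurableType d') (X0 : Type)
    (F : R -> Y -> Y) (xi : X0 -> R) (T : X0 -> X0)
    (G : R -> X0 * R -> X0 * R) (Phi : Y -> X0 * R) (Psi : X0 * R -> Y)
    (N : set Y) (z z' : X0) (t u u' : R) :
  flow_under T xi G -> (forall z, 0 < xi z) ->
  (forall w w' t, ~ N w -> ~ N w' ->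
    (forall r, G (r + t) (Phi w) = G r (G t (Phi w))) ->
    G t (Phi w) = Phi w' -> F t w = w') ->
  G t (z, 0) = (z', 0) ->
  under_graph xi (z, u) -> under_graph xi (z', u') ->
  Phi (Psi (z, u)) = (z, u) -> Phi (Psi (z', u')) = (z', u') ->
  ~ N (Psi (z, u)) -> ~ N (Psi (z', u')) ->
  F (t + u' - u) (Psi (z, u)) = Psi (z', u').
Proof.
move=> GT xi0 FG Gt zu zu' Pu Pu' Nu Nu'.
have [_ _ GD _ _] := GT.
apply: FG => //; rewrite Pu; first by move=> r; exact: GD.
by rewrite Pu'; exact: (flow_under_height GT xi0 Gt).
Qed.

Section Limsup.
Context {R : realType}.

Lemma limf_esup_lt_near (h : R -> \bar R) (c : \bar R) :
  (limf_esup h (pinfty_nbhs R) < c)%E -> exists S, forall s, S < s -> (h s < c)%E.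
Proof.
move=> /ereal_inf_lt[_ [V [S [_ SV]] <-] Vc].
exists S => s /SV Vs; apply: le_lt_trans Vc.
by apply: ereal_sup_ubound; exists s.
Qed.

Lemma limf_esup_gt_frequently (h : R -> \bar R) (c : \bar R) :
  (c < limf_esup h (pinfty_nbhs R))%E -> forall S, exists2 s, S < s & (c < h s)%E.
Proof.
move=> ch S; apply: contrapT => H; move: ch; apply/negP; rewrite -leNgt.
apply: ge_ereal_inf; exists (ereal_sup (h @` [set s | S < s])).
  by exists [set s | S < s] => //; exists S; split=> //; exact: num_real.
apply: ge_ereal_sup => _ [s /= Ss <-]; rewrite leNgt; apply/negP => cs.
by apply: H; exists s.
Qed.

(** The endpoints of the window at scale [s] move by an unbounded amount as [s]
    grows when the width is doubled: [expR (r + zeta) - expR r] is at least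
    [zeta * expR r]. *)
Lemma window_perturb (zeta c : R) : 0 < zeta -> 0 <= c ->
  exists S, forall s v v', S < s -> window s zeta v -> `|v' - v| <= c ->
    window s (2 * zeta) v'.
Proof.
move=> z0 c0; exists (c / zeta + 2 * zeta) => s v v' Ss.
have gap r : c / zeta < r -> expR r + c < expR (r + zeta).
  move=> cr; rewrite expRD -ltrBrDl -[X in _ - X]mulr1 -mulrBr.
  have r0 : 0 < r by apply: le_lt_trans cr; rewrite divr_ge0// ltW.
  apply: (@lt_le_trans _ _ (expR r * zeta)).
    rewrite -ltr_pdivrMr//; apply: (lt_trans cr); apply: lt_le_trans (expR_ge1Dx r).
    by rewrite ltrDr.
  rewrite ler_wpM2l ?expR_ge0// lerBrDl; exact: expR_ge1Dx.
have up : expR (s + zeta) + c < expR (s + 2 * zeta).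
  have -> : s + 2 * zeta = s + zeta + zeta by ring.
  by apply: gap; lra.
have lo : expR (s - 2 * zeta) + c < expR (s - zeta).
  have -> : s - zeta = s - 2 * zeta + zeta by ring.
  by apply: gap; lra.
rewrite ler_norml => -[/= /andP[v1 v2]|/= /andP[v1 v2]] /andP[d1 d2].
  by left; apply/andP; split; lra.
by right; apply/andP; split; lra.
Qed.

End Limsup.

Section Slices.
Context {R : realType} d (X : measurableType d).
Variable n : {sigma_finite_measure set X -> \bar R}.

(** The product of [n] restricted to [A] and of Lebesgue measure restricted to
    [I] is finite, and the limit superior of the [Z k] is null for it.  Hence the
    measures of the [Z k] have no positive lower bound, whereas each is at
    least [b * c] by Markov's inequality. *)
Lemma slices_not_bounded_below (A : set X) (I : set R) (Z : nat -> set (X * R))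
    (K : nat -> set X) (b : R) (c : \bar R) :
  measurable A -> (n A < +oo)%E ->
  measurable I -> (lebesgue_measure I < +oo)%E ->
  (forall k, measurable (Z k)) ->
  {ae n, forall x, lebesgue_measure (xsection (lim_sup_set Z) x) = 0%E} ->
  0 < b -> (0 < c)%E -> (forall k, K k `<=` A) ->
  (forall k x, K k x -> b%:E <= lebesgue_measure (xsection (Z k) x `&` I))%E ->
  ~ forall k, (c < mu_ext n (K k))%E.
Proof.
move=> mA Aoo mI Ioo mZ Z0 b0 c0 KA Kb Kc.
pose nA : {finite_measure set X -> \bar R} := mfrestr mA Aoo.
pose lI : {finite_measure set (measurableTypeR R) -> \bar R} :=
  @mfrestr _ (measurableTypeR R) R I lebesgue_measure mI Ioo.
pose kappa : {measure set (X * measurableTypeR R) -> \bar R} := (nA \x lI)%E.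
have mZR k : @measurable _ (X * measurableTypeR R)%type (Z k) by exact: mZ.
have mlim : @measurable _ (X * measurableTypeR R)%type (lim_sup_set Z).
  by apply: bigcapT_measurable => k; apply: bigcup_measurable => i _.
have mX Q : @measurable _ (X * measurableTypeR R)%type Q ->
    measurable_fun setT (fun x => lI (xsection Q x)).
  by move=> mQ; exact: measurable_fun_xsection.
have kappa_lim : kappa (lim_sup_set Z) = 0%E.
  apply/ge0_integral_eq0_ae => //; first exact: mX.
  have nAn : nA `<< n.
    apply/null_content_dominatesP => N mN N0.
    by apply: (@subset_measure0 _ _ _ n _ N) => //; exact: measurableI.
  apply: (null_dominates_negligible nAn); apply: negligibleS Z0 => x /= + Zx0; apply.
  rewrite /lI/= /mfrestr /mrestr.
  apply: (@subset_measure0 _ _ _ lebesgue_measure _ (xsection (lim_sup_set Z) x)) => //.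
  - by apply: measurableI => //; exact: measurable_xsection.
  - exact: measurable_xsection.
have kappa_ge k : (b%:E * c <= kappa (Z k))%E.
  pose g x := lI (xsection (Z k) x).
  have mg : measurable_fun setT g by exact: mX.
  pose H := [set x | (b%:E <= g x)%E].
  have mH : measurable H.
    by rewrite -[X in measurable X]setTI; exact: emeasurable_fun_c_infty.
  apply: (@le_trans _ _ (b%:E * nA H)%E).
    apply: lee_wpmul2l; first by rewrite lee_fin ltW.
    apply: le_trans (ltW (Kc k)) _.
    apply: mu_ext_le_measure; first exact: measurableI.
    by move=> x Kx; split; [exact: Kb|exact: KA Kx].
  rewrite -integral_cst//; apply: (@le_trans _ _ (\int[nA]_(x in H) g x)%E).
    apply: ge0_le_integral => //.
    - by move=> x _; rewrite lee_fin ltW.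
    - exact: measurable_funTS.
  by apply: ge0_subset_integral.
have kappaT : (kappa setT < +oo)%E.
  rewrite -setXTT /kappa/= product_measure1E//.
  by apply: lte_mul_pinfty => //; [exact: fin_num_measure|exact: fin_num_fun_lty].
have cupT : (kappa (\bigcup_(k in [set k | (0 <= k)%N]) Z k) < +oo)%E.
  apply: le_lt_trans kappaT; apply: le_measure; rewrite ?inE//.
  by apply: bigcup_measurable.
have := lim_sup_set_cvg kappa Z mZR cupT; rewrite kappa_lim => /cvg_lim lim0.
have bc0 : (0 < b%:E * c)%E by apply: mule_gt0.
have : (b%:E * c <= 0)%E.
  rewrite -lim0//; apply: lime_ge.
    apply: ereal_nonincreasing_is_cvgn => i j ij.
    rewrite le_measure ?inE//; [exact: bigcup_measurable..|].
    by apply: bigcup_subset => k /=; exact: leq_trans.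
  apply: nearW => k; apply: le_trans (kappa_ge k) _; apply: le_measure; rewrite ?inE//.
    exact: bigcup_measurable.
  by apply: bigcup_sup => /=.
by rewrite leNgt bc0.
Qed.
End Slices.

(** Every initial segment of [V] lies in the longer ones, whose measures are
    eventually below any given bound. *)
Lemma null_of_small_segments (R : realType) (V : set R) :
  measurable V -> V `<=` [set u | 0 <= u] ->
  (forall j, (lebesgue_measure (V `&` [set` `[0%R, j.+1%:R%R]]) <=
     j.+1%:R^-1%:E)%E) ->
  lebesgue_measure V = 0%E.
Proof.
move=> mV V0 Vj.
pose leb : {measure set (measurableTypeR R) -> \bar R} := lebesgue_measure.
pose J j : set R := V `&` [set` `[0, j.+1%:R]].
have mJ j : measurable (J j) by apply: measurableI => //; exact: measurable_itv.
have J0 i : leb (J i) = 0%E.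
  apply/eqP; rewrite eq_le measure_ge0 andbT; apply/lee_addgt0Pr => e e0.
  have [k ke] := ltr_add_invr e0; rewrite add0r in ke; rewrite add0e.
  apply: (@le_trans _ _ (leb (J (maxn i k)))).
    apply: le_measure; rewrite ?inE; [exact: mJ..|].
    apply: setIS => u; rewrite /= !in_itv/= => /andP[-> /le_trans]; apply.
    by rewrite ler_nat ltnS leq_maxl.
  apply: le_trans (Vj _) _; rewrite lee_fin.
  by apply: le_trans (ltW ke); rewrite lef_pV2 ?posrE ?ltr0n// ler_nat ltnS leq_maxr.
have nU : leb.-negligible (\bigcup_i J i).
  by apply: negligible_bigcup => i; apply/negligibleP; [exact: mJ|exact: J0].
apply/(@negligibleP _ _ _ leb); first exact: mV.
apply: negligibleS nU => u Vu; exists (Num.truncn u) => //; split=> //=.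
by rewrite in_itv/= V0//= ltW// truncnS_gt.
Qed.

Section VanishingRecurrence.
Context {R : realType} d (X : measurableType d) d0 (X0 : measurableType d0)
  d' (Y : measurableType d').
Variables (m : {sigma_finite_measure set X -> \bar R})
  (n : {sigma_finite_measure set X -> \bar R})
  (nu : {sigma_finite_measure set Y -> \bar R}) (E : set (X * X))
  (F : R -> Y -> Y) (dm dn : X -> X -> R)
  (pi : X -> X0) (xi : X0 -> R) (T : X0 -> X0) (G : R -> X0 * R -> X0 * R).

Let la := fun C : set (X0 * R) =>
  (pushforward m pi \x lebesgue_measure)%E (C `&` under_graph xi).

(** [slice U] is the set of pairs [(x, u)] for which [Psi] maps the point at
    height [u] over [pi x] into [U].  The set [A] is chosen so that the fibers of
    [slice C] have measure bounded below at bounded heights, and so that [m]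
    and [n] are comparable on it; the points where an almost everywhere
    property fails are then removed. *)
Theorem vanishing_recurrence (zeta : R) :
  standard_borel (R := R) X -> countable_measured_rel m E ->
  equiv_measure m n ->
  RN_cocycle m E dm -> lacunary E dm -> RN_cocycle n E dn ->
  ergodic_decomposition m (unimodular_part E dm) pi ->
  measurable_fun [set: X0] xi -> (forall z, 0 < xi z) ->
  {ae m, forall x, log_jumps E dm x (xi (pi x)) /\
                   lbound (log_jumps E dm x) (xi (pi x))} ->
  {ae m, forall x, forall x', E (x, x') ->
           ln (dm x' x) = xi (pi x) -> T (pi x) = pi x'} ->
  flow_under T xi G -> conjugate_flows nu F la G ->
  measurable_flow nu F -> propertyB nu F -> 0 < zeta ->
  exists A, [/\ measurable A, n A <> 0%E & forall B c, B `<=` A -> (0 < c)%E ->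
    ~ (c < limf_esup (fun s : R => mu_ext n (recurrent_part E dn B s zeta))
             (pinfty_nbhs R))%E].
Proof.
move=> sX Ecm eqv RNm lac RNn edec mxi xi0 jump Tpi GT.
move=> [Phi [Psi [[mPhi mPsi] PK KP Phi0 equivar]]] mF [C [mC C0 Cret]] z0.
have [_ mpi _ _] := edec.
have [Eeq _ _ _] := Ecm; have [_ Esym _] := Eeq.
have [_ dm0 _ _] := RNm; have [_ dn0 _ _] := RNn.
have [No No0 orbG] := orbit_flow Ecm RNm lac edec xi0 jump Tpi GT.
have [N' [D [mD D0 N'D]] FG'] := flow_eq_of_conj mF PK equivar.
have FG w w' t (Dw : ~ D w) (Dw' : ~ D w') :=
  FG' w w' t (contra_not (@N'D w) Dw) (contra_not (@N'D w') Dw').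
have [Q [mQ Q0 KPQ]] := KP.
have PhiPsi z : ~ Q z -> Phi (Psi z) = z.
  by move=> Qz; apply: contrapT => /KPQ.
have cnull := conj_null mpi mxi mPhi mPsi PK Phi0.
pose slice (U : set Y) := lift_to_base pi xi (Psi @^-1` U).
have mslice U : measurable U -> measurable (slice U).
  move=> mU; apply: measurable_lift => //.
  by rewrite -[X in measurable X]setTI; exact: mPsi.
have mxslice U x : measurable U -> measurable (xsection (slice U) x).
  by move=> mU; apply: measurable_xsection; exact: mslice.
have sliceP U x u : xsection (slice U) x u <->
    U (Psi (pi x, u)) /\ under_graph xi (pi x, u).
  by rewrite /xsection/= inE.
have D0ae := (cnull D mD).1 D0.
have Q0ae := (la_null m mpi mxi mQ).1 Q0.
pose leb : {measure set (measurableTypeR R) -> \bar R} := lebesgue_measure.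
pose J (j : nat) : set R := [set` `[0, j.+1%:R]].
have mJ j : measurable (J j) by exact: measurable_itv.
have Joo j : (leb (J j) < +oo)%E.
  have := @lebesgue_measure_itv R `[0, j.+1%:R].
  rewrite /= lte_fin ltr0n oppr0 adde0 => JE.
  by rewrite [X in (X < _)%E](_ : _ = j.+1%:R%:E) ?ltry//; exact: JE.
pose V j := [set x | j.+1%:R^-1%:E < leb (xsection (slice C) x `&` J j)]%E.
have mV j : measurable (V j).
  have mfV : measurable_fun setT (fun x => leb (xsection (slice C) x `&` J j)).
    have := measurable_fun_xsection lebesgue_measure
      (measurableI _ _ (mslice C mC) (measurableX measurableT (mJ j))).
    congr (measurable_fun _ _); apply/funext => x /=; rewrite /leb; congr (lebesgue_measure _).
    apply/seteqP; split=> u; rewrite /xsection/=.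
      by move=> /set_mem[? [_ ?]]; split=> //; exact: mem_set.
    by move=> [/set_mem ? ?]; apply: mem_set; split.
  by rewrite -[X in measurable X]setTI; exact: emeasurable_fun_o_infty.
(* If all the [V j] were null, almost every fiber of [slice C] would be null,
   and so would be [C]. *)
have [j nVj] : exists j, n (V j) <> 0%E.
  apply/existsNP => H.
  have Vae : {ae n, forall x j, ~ V j x}.
    apply: ae_foralln => j; apply: (@negligibleS _ _ _ _ (V j)).
      by move=> x /= /contrapT.
    by apply/negligibleP => //; exact: contrapT (H j).
  have : nu C = 0%E.
    apply/cnull => //; apply: (null_dominates_negligible eqv.1).
    apply: negligibleS Vae => x /=; apply: contra_not => Vx.
    apply: null_of_small_segments => [|u /sliceP[_ /andP[]//]|j].
      exact: mxslice.
    by rewrite leNgt; apply/negP; exact: Vx.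
  by move=> nuC; move: C0; rewrite nuC ltxx.
have [a [A [a1 mA AV nA [Aoo cmp]]]] := comparable_subset eqv.2 (mV j) nVj.
pose M := a * a + 1.
have M1 : 1 <= M by rewrite /M -[leLHS]add0r lerD2r mulr_ge0// (le_trans _ a1).
have M0 : 0 < M by exact: lt_le_trans M1.
have ratio := cocycle_ratio_bound sX Ecm eqv RNm RNn mA Aoo cmp a1 (ltr_pwDr ltr01 (lexx (a * a))).
(* [D] contains the points of [Y] where the conjugacy misbehaves, and [Q] those of
   the flow space. *)
pose bad x := [\/ No x, (exists y, [/\ A x, A y, E (x, y) & M * dm y x < dn y x]),
  leb (xsection (slice D) x) <> 0%E | leb (xsection (lift_to_base pi xi Q) x) <> 0%E].
have [N [mN N0 badN]] : m.-negligible bad.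
  apply: negligibleS (negligibleU No0 (negligibleU ratio (negligibleU D0ae Q0ae))).
  by move=> x [?|?|?|?]; [left|right; left|right; right; left|right; right; right].
have badP x : ~ N x -> [/\ ~ No x,
    forall y, A x -> A y -> E (x, y) -> dn y x <= M * dm y x,
    leb (xsection (slice D) x) = 0%E &
    leb (xsection (lift_to_base pi xi Q) x) = 0%E].
  move=> Nx; have nbad : ~ bad x by move=> /badN.
  split.
  - by move=> Nox; apply: nbad; constructor 1.
  - move=> y Ax Ay Exy; rewrite leNgt; apply/negP => lt; apply: nbad.
    by constructor 2; exists y.
  - by apply: contrapT => h; apply: nbad; constructor 3.
  - by apply: contrapT => h; apply: nbad; constructor 4.
have mxQ x : measurable (xsection (lift_to_base pi xi Q) x).
  by apply: measurable_xsection; exact: measurable_lift.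
have nN0 : n N = 0%E by apply/(equiv_measure_null eqv).
exists (A `\` N); split=> [|A0|B c BA c0 limc]; first exact: measurableD.
  apply: nA; apply/negligibleP => //.
  apply: negligibleS (negligibleU ((negligibleP n (measurableD mA mN)).2 A0) ((negligibleP n mN).2 nN0)).
  by move=> x Ax; have [?|?] := pselect (N x); [right|left].
have [S HS] := window_perturb (c := ln M + j.+1%:R) z0 (addr_ge0 (ln_ge0 M1) (ler0n _ _)).
have z20 : 0 < 2 * zeta by rewrite mulr_gt0.
(* Scales [s k] at which the returns of [C] have measure less than
   [2 ^- k.+1], while the recurrent part of [B] has outer measure at least [c]. *)
have /choice[s Hs] (k : nat) : exists s, [/\ S < s, (c < mu_ext n (recurrent_part E dn B s zeta))%E &
    exists U, [/\ measurable U, returns F (2 * zeta) s C `<=` U & (nu U < (1 / 2 ^+ k.+1)%:E)%E]].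
  have [|S' HS'] := @limf_esup_lt_near R (fun s => mu_ext nu (returns F (2 * zeta) s C)) (1 / 2 ^+ k.+1)%:E.
    by rewrite Cret// lte_fin divr_gt0// exprn_gt0.
  have [s Ss cs] := limf_esup_gt_frequently limc (Num.max S S').
  move: Ss; rewrite gt_max => /andP[Ss S's].
  by exists s; split=> //; apply: mu_ext_measurable_cover; exact: HS'.
have Ss k : S < s k by have [] := Hs k.
have cs k : (c < mu_ext n (recurrent_part E dn B (s k) zeta))%E by have [] := Hs k.
have /choice[U HU] k : exists U, [/\ measurable U, returns F (2 * zeta) (s k) C `<=` U & (nu U < (1 / 2 ^+ k.+1)%:E)%E].
  by have [] := Hs k.
have mU k : measurable (U k) by have [] := HU k.
have mlim : measurable (lim_sup_set U).
  by apply: bigcapT_measurable => k; apply: bigcup_measurable => i _.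
have lim0 : nu (lim_sup_set U) = 0%E.
  by apply: borel_cantelli_half => // k; have [] := HU k.
apply: (@slices_not_bounded_below _ _ _ n A (J j) (fun k => slice (U k))
  (fun k => recurrent_part E dn B (s k) zeta) j.+1%:R^-1 c) cs => //.
- exact: Joo.
- by move=> k; exact: mslice.
- apply: (null_dominates_negligible eqv.2).
  move: lim0 => /(cnull _ mlim); apply: negligibleS => x /=; apply: contra_not.
  rewrite (_ : xsection (lim_sup_set _) x = xsection (slice (lim_sup_set U)) x)//.
  apply/seteqP; split=> u.
    rewrite {1}/xsection/= inE => H; apply/sliceP; split.
      move=> k _; have [i ki [/= Ui _]] := H k I; by exists i.
    by have [i ki [/= _ ug]] := H 0%N I.
  move/sliceP => [H ug]; rewrite /xsection/= inE => k _.
  by have [i ki Ui] := H k I; exists i.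
- by move=> k x [/BA[]].
- move=> k x [Bx [_ [[y [Exy By] <-] win]]].
  have [Ax Nx] := BA _ Bx; have [Ay Ny] := BA _ By.
  have [Nox rx Dx Qx] := badP _ Nx; have [_ ry Dy Qy] := badP _ Ny.
  have Eyx := Esym _ _ Exy.
  (* One good height over [y] serves all the heights over [x]. *)
  have [u' [Cu' Ju'] [nDu' nQu']] : exists2 u', (xsection (slice C) y `&` J j) u' &
      ~ xsection (slice D) y u' /\ ~ xsection (lift_to_base pi xi Q) y u'.
    apply: contrapT => H.
    have : (leb (xsection (slice C) y `&` J j) <= leb set0)%E.
      apply: (le_measure_mod_null _ measurable0 _ _ Dy Qy) => //.
      - exact: measurableI (mxslice _ _ mC) (mJ _).
      - exact: mxslice.
      - exact: mxQ.
      - move=> u Cu; have [?|nDu] := pselect (xsection (slice D) y u).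
          by left; right.
        have [?|nQu] := pselect (xsection (lift_to_base pi xi Q) y u); first by right.
        by exfalso; apply: H; exists u.
    rewrite measure0 leNgt => /negP; apply; apply: lt_trans (AV _ Ay).
    by rewrite lte_fin invr_gt0 ltr0n.
  apply: (le_trans (ltW (AV _ Ax))).
  apply: (le_measure_mod_null _ _ _ _ Dx Qx) => //.
  - exact: measurableI (mxslice _ _ mC) (mJ _).
  - exact: measurableI (mxslice _ _ (mU k)) (mJ _).
  - exact: mxslice.
  - exact: mxQ.
  move=> u [Cu Ju]; have [?|nDu] := pselect (xsection (slice D) x u).
    by left; right.
  have [?|nQu] := pselect (xsection (lift_to_base pi xi Q) x u); first by right.
  left; left; split=> //.
  have [Cw ug] := (sliceP _ _ _).1 Cu; have [Cw' ug'] := (sliceP _ _ _).1 Cu'.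
  apply/sliceP; split=> //.
  have [_ retU _] := HU k; apply: retU; split=> //.
  have Dw : ~ D (Psi (pi x, u)) by move=> Dw; apply: nDu; apply/sliceP.
  have Dw' : ~ D (Psi (pi y, u')) by move=> Dw'; apply: nDu'; apply/sliceP.
  have Pw : Phi (Psi (pi x, u)) = (pi x, u).
    by apply: PhiPsi => Qw; apply: nQu; rewrite /xsection/= inE.
  have Pw' : Phi (Psi (pi y, u')) = (pi y, u').
    by apply: PhiPsi => Qw; apply: nQu'; rewrite /xsection/= inE.
  exists (ln (dm y x) + u' - u); last first.
    by rewrite (flow_between_fibers GT xi0 FG (orbG _ _ Nox Exy) ug ug').
  apply: (HS _ _ _ (Ss k) win).
  have lnd : `|ln (dm y x) - ln (dn y x)| <= ln M.
    apply: ln_dist_le; [exact: dn0|exact: dm0|exact: M0|exact: rx|].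
    by rewrite -(cocycle_inv Eeq RNn Exy) -(cocycle_inv Eeq RNm Exy); exact: ry.
  have uu : `|u' - u| <= j.+1%:R.
    move: Ju Ju'; rewrite /J/= !in_itv/= => /andP[u0 uj] /andP[u'0 u'j].
    by rewrite ler_norml; apply/andP; split; lra.
  rewrite (_ : _ - _ = ln (dm y x) - ln (dn y x) + (u' - u)); last by ring.
  by apply: le_trans (ler_normD _ _) _; exact: lerD.
Qed.
End VanishingRecurrence.

(** * The theorem *)

Theorem theorem4p2 (R : realType)
    (d : measure_display) (X : measurableType d)
    (mu : {sigma_finite_measure set X -> \bar R})
    (E : set (X * X))
    (d' : measure_display) (Y : measurableType d')
    (nu : {sigma_finite_measure set Y -> \bar R})
    (F : R -> Y -> Y) :
  standard_borel (R := R) X ->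
  countable_measured_rel mu E ->
  ergodic_rel mu E ->
  hyperfinite_rel mu E ->
  type_III0 mu E ->
  standard_borel (R := R) Y ->
  measurable_flow nu F ->
  associated_flow mu E nu F ->
  propertyB nu F ->
  ~ propertyA mu E.
Proof.
move=> sX Ecm _ _ _ _ mF assoc PB [n [dn [eta [zeta [eqn RNn eta0 zeta0 PA]]]]].
case: assoc => m [dm [d0 [X0 [pi [xi [T [G [[eqm [RNm lac]] edec]]]]]]]].
move=> [mxi xi0 jump] [_ Tpi] [GT conj].
have eqmn : equiv_measure m n.
  by split; [exact: null_dominates_trans eqm.2 eqn.1|exact: null_dominates_trans eqn.2 eqm.1].
have pos A : measurable A -> n A <> 0%E <-> (0 < mu A)%E.
  move=> mA; rewrite lt0e measure_ge0 andbT; split=> [nA|/eqP muA].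
    by apply/eqP => /(equiv_measure_null eqn mA).
  by move=> /(equiv_measure_null eqn mA).
have [A [mA nA vanish]] := vanishing_recurrence sX
  (countable_measured_rel_equiv eqm Ecm) eqmn RNm lac RNn edec mxi xi0 jump Tpi
  GT conj mF PB zeta0.
have [B [mB BA muB lim]] := PA A mA ((pos A mA).1 nA).
apply: vanish BA _ lim; apply: mule_gt0 => //.
by rewrite lt0e measure_ge0 andbT; apply/eqP; apply/(pos B mB).
Qed.
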